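(* If $\mathrm{SL}_2(5)$ acts freely on $S^3$ in such a way that the action restricted to a cyclic subgroup of order $5$ is conjugate to a free linear action, then the $\mathrm{SL}_2(5)$-action embeds in a free linear action on $S^7$.
   Context: $\mathrm{SL}_2(5)$ is the group of $2\times 2$ matrices of determinant $1$ over the field $\mathbb{F}_5$; it is isomorphic to the binary icosahedral group. Actions on $S^{2n-1}$ are topological, given by homomorphisms to the group $\mathrm{Top}^+(S^{2n-1})$ of orientation preserving homeomorphisms, and conjugate means conjugate in that group. A free linear action of a finite group on $S^{2n-1}$ is a free action given by a homomorphism to $\mathrm{SO}_{2n}$ acting on the unit sphere in $\mathbb{R}^{2n}$. An action of a group on $S^3$ embeds in an action of the same group on $S^7$ if there is an equivariant embedding of $S^3$ into $S^7$, so that the given action is the restriction of the action on $S^7$ to an invariant embedded $S^3$. *)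

(* Defs.v *)
From HB Require Import structures.
From mathcomp Require Import all_boot all_order all_fingroup all_algebra.
From mathcomp Require Import all_solvable mxrepresentation.
From mathcomp.multinomials Require Import freeg.
From mathcomp Require Import mathcomp_extra boolp classical_sets functions.
From mathcomp Require Import reals topology normedtype.

Set Implicit Arguments.
Unset Strict Implicit.
Unset Printing Implicit Defensive.

Import Order.TTheory GRing.Theory Num.Theory numFieldNormedType.Exports.

Local Open Scope classical_set_scope.
Local Open Scope ring_scope.

Definition unit_sphere (R : realType) (k : nat) : set 'cV[R]_k.+1 :=
  [set x | \sum_(i < k.+1) x i 0 ^+ 2 = 1].

(* The space S^k: as a [set_type] it has the subspace topology. *)
Definition sphere (R : realType) (k : nat) : Type :=
  set_type (@unit_sphere R k).

(* Integral singular chains; [R] serves as the real line underlying the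
   standard simplices. *)

Definition std_simplex (R : realType) (n : nat) : set 'cV[R]_n.+1 :=
  [set t | (forall i, 0 <= t i 0) /\ \sum_(i < n.+1) t i 0 = 1].

Definition simplex (R : realType) (n : nat) : Type :=
  set_type (@std_simplex R n).

Section Face.
Variables (R : realType) (n : nat) (i : 'I_n.+2).

(* [face i] inserts a zero barycentric coordinate at position [i]. *)
Definition face_mx (t : 'cV[R]_n.+1) : 'cV[R]_n.+2 :=
  \col_j (if unlift i j is Some l then t l 0 else 0).

Lemma face_subproof (t : simplex R n) :
  face_mx (val t) \in @std_simplex R n.+1.
Proof.
have [t_ge0 t_sum1] := set_mem (valP t).
apply/mem_set; split=> [j|].
  by rewrite mxE; case: unliftP => [l _|_].
rewrite (bigD1_ord i) //= mxE unlift_none add0r -[RHS]t_sum1.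
by apply: eq_bigr => l _; rewrite mxE liftK.
Qed.

Definition face (t : simplex R n) : simplex R n.+1 :=
  exist _ (face_mx (val t)) (face_subproof t).

Lemma face_continuous : continuous face.
Proof.
apply: (@continuous_comp_initial (simplex R n.+1) _ _ set_val face).
move=> t U [P Pnbhs PU].
have valC : continuous (set_val : simplex R n -> 'cV[R]_n.+1).
  exact: initial_continuous.
apply: (valC t [set M | U (face_mx M)]).
exists (fun l m => if m == 0 :> 'I_1 then P (fintype.lift i l) 0 else setT)
  => [l m|M /= PM].
  case: eqP => [->|_]; last exact: filterT.
  by have := Pnbhs (fintype.lift i l) 0; rewrite mxE liftK.
apply: PU => j m; rewrite /= mxE (ord1 m).
case: unliftP => [l ->|->]; first exact: PM l 0.
by have /nbhs_singleton := Pnbhs i 0; rewrite mxE unlift_none.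
Qed.

HB.instance Definition _ :=
  isContinuous.Build (simplex R n) (simplex R n.+1) face face_continuous.

End Face.

Definition chain (R : realType) (X : topologicalType) (n : nat) : Type :=
  {freeg (continuousType (simplex R n) X) / int}.

Definition push (R : realType) (X Y : topologicalType) (n : nat)
    (f : continuousType X Y) : chain R X n -> chain R Y n :=
  fglift (fun s : continuousType (simplex R n) X =>
    << 1 *g (f \o s : continuousType (simplex R n) Y) >>).

Definition boundary (R : realType) (X : topologicalType) (n : nat) :
    chain R X n.+1 -> chain R X n :=
  fglift (fun s : continuousType (simplex R n.+1) X =>
    \sum_(i < n.+2)
      << (-1) ^+ i *g (s \o face i : continuousType (simplex R n) X) >>).

Definition is_cycle (R : realType) (X : topologicalType) (n : nat) :
    chain R X n -> Prop :=
  match n with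
  | 0 => fun _ => True
  | m.+1 => fun c => boundary c = 0
  end.

(* [f] has degree 1, i.e. it induces the identity of H_k(S^k; Z). *)
Definition orientation_preserving (R : realType) (k : nat)
    (f : continuousType (sphere R k) (sphere R k)) : Prop :=
  forall c : chain R (sphere R k) k, is_cycle c ->
  exists b : chain R (sphere R k) k.+1, push f c - c = boundary b.

Definition Top_plus (R : realType) (k : nat) : set (sphere R k -> sphere R k) :=
  [set f | (exists g : sphere R k -> sphere R k,
              [/\ continuous g, cancel f g & cancel g f]) /\
           exists f_cts : continuous f, orientation_preserving (mkcts f_cts)].

Definition SO (R : realType) (n : nat) : set 'M[R]_n :=
  [set A | A *m A^T = 1%:M /\ \det A = 1].

(* In the following, an action of [G] is a left action by functions [a g], of
   which only those with [g \in G] matter. *)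

(* [a] is a homomorphism from [G] to Top^+(S^k). *)
Definition top_action (R : realType) (k : nat) (gT : finGroupType)
    (G : {group gT}) (a : gT -> sphere R k -> sphere R k) : Prop :=
  {in G, forall g, Top_plus (a g)} /\
  {in G &, forall g h, a (g * h)%g = a g \o a h}.

Definition free_action (T : Type) (gT : finGroupType) (G : {group gT})
    (a : gT -> T -> T) : Prop :=
  {in G, forall g, g != 1%g -> forall x, a g x <> x}.

Definition linear_action (R : realType) (k : nat) (gT : finGroupType)
    (G : {group gT}) (a : gT -> sphere R k -> sphere R k) : Prop :=
  exists rho : mx_representation R G k.+1,
  {in G, forall g, SO (rho g) /\ forall x, val (a g x) = rho g *m val x}.

Definition free_linear_action (R : realType) (k : nat) (gT : finGroupType)
    (G : {group gT}) (a : gT -> sphere R k -> sphere R k) : Prop :=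
  linear_action G a /\ free_action G a.

Definition equivariant (T U : Type) (gT : finGroupType) (G : {group gT})
    (a : gT -> T -> T) (b : gT -> U -> U) (f : T -> U) : Prop :=
  {in G, forall g x, f (a g x) = b g (f x)}.

(* Conjugate in Top^+(S^k). *)
Definition conjugate_actions (R : realType) (k : nat) (gT : finGroupType)
    (G : {group gT}) (a b : gT -> sphere R k -> sphere R k) : Prop :=
  exists2 h, Top_plus h & equivariant G a b h.

(* A homeomorphism onto the image with its subspace topology. *)
Definition embedding (X Y : topologicalType) (e : X -> Y) : Prop :=
  [/\ continuous e, injective e &
      forall U : set X, open U -> exists2 V : set Y, open V & e @^-1` V = U].

Definition embeds_in (R : realType) (k l : nat) (gT : finGroupType)
    (G : {group gT}) (a : gT -> sphere R k -> sphere R k)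
    (b : gT -> sphere R l -> sphere R l) : Prop :=
  exists2 e : sphere R k -> sphere R l, embedding e & equivariant G a b e.

Definition SL2_5_set : {set {'GL_2(5)}} :=
  [set g : {'GL_2(5)} | \det (GLval g) == 1]%SET.

Lemma SL2_5_group_set : group_set SL2_5_set.
Proof.
apply/group_setP; split=> [|g h]; first by rewrite inE GL_1E det1.
by rewrite !inE GL_ME det_mulmx => /eqP-> /eqP->; rewrite mulr1.
Qed.

Definition SL2_5 : {group {'GL_2(5)}} := Group SL2_5_group_set.

(* Main.v *)
Require Import Defs.
From mathcomp Require Import all_boot all_fingroup all_algebra all_solvable.
From mathcomp Require Import reals.
From mathcomp Require Import all_order mxrepresentation.
From mathcomp Require Import boolp classical_sets functions.
From mathcomp Require Import topology normedtype realfun lra.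

(** Let [rho] be a representation of [G] in [SO(8)] that is free on [S^7]; for
[G = SL_2(5)] the binary icosahedral group acts by left multiplication on
[H^2]. It suffices to find an equivariant map [F : S^3 -> R^8] such that
[F x <> c F y] whenever [x] and [y] are in different orbits and [0 <= c <= 1]:
then [F] has no zero, and [F / |F|] is injective on each orbit because [rho] is
free, and across orbits by the choice of [F].

Such maps are generic. For two small balls whose orbits are disjoint, the
values of an equivariant map on the two balls can be perturbed independently, so
approximate it on both by a Lipschitz map [P], and add a small constant [w] on
the first ball. The vectors [w] with [P x + w = c P y] for some [x], [y], [c]
form the Lipschitz image of a set of dimension [3 + 3 + 1 < 8], so almost every
[w] works. A Baire category argument then treats countably many pairs of
balls. *)

Set Implicit Arguments.
Unset Strict Implicit.
Unset Printing Implicit Defensive.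

Import Order.TTheory GRing.Theory Num.Theory numFieldNormedType.Exports.

Local Open Scope ring_scope.

(** * The binary icosahedral group *)

Definition quat (T : Type) : Type := (T * T * T * T)%type.

Definition quat_map (S T : Type) (f : S -> T) (p : quat S) : quat T :=
  let: (a, b, c, d) := p in (f a, f b, f c, f d).

(** The operations are parameters so that one formula serves both the real quaternions and the
    integer pairs of [zphi], on which it computes. *)
Definition quat_mul (T : Type) (add sub mul : T -> T -> T) (p q : quat T) :
    quat T :=
  let: (a, b, c, d) := p in let: (x, y, z, t) := q in
  (sub (sub (sub (mul a x) (mul b y)) (mul c z)) (mul d t),
   sub (add (add (mul a y) (mul b x)) (mul c t)) (mul d z),
   add (add (sub (mul a z) (mul b t)) (mul c x)) (mul d y),
   add (sub (add (mul a t) (mul b z)) (mul c y)) (mul d x)).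

Definition quat_norm (T : Type) (add mul : T -> T -> T) (p : quat T) : T :=
  let: (a, b, c, d) := p in
  add (add (add (mul a a) (mul b b)) (mul c c)) (mul d d).

(** * Real quaternions as 4 by 4 matrices *)

Section QuaternionMatrix.
Variable R : realType.
Implicit Types p q : quat R.

(** Left multiplication by [a + b i + c j + d k] on the quaternions, in the basis [1, i, j, k]. *)
Definition quat_mx p : 'M[R]_4 :=
  let: (a, b, c, d) := p in
  \matrix_(i, j) nth 0 (nth [::] [:: [:: a; - b; - c; - d];
                                     [:: b; a; - d; c];
                                     [:: c; d; a; - b];
                                     [:: d; - c; b; a]] i) j.

Lemma quat_mxM p q :
  quat_mx p *m quat_mx q = quat_mx (quat_mul +%R (fun x y => x - y) *%R p q).
Proof.
case: p q => [[[a b] c] d] [[[x y] z] t].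
apply/matrixP => i j; rewrite !mxE !big_ord_recl big_ord0 !mxE /=.
by case: i => [[|[|[|[|//]]]] ?]; case: j => [[|[|[|[|//]]]] ?] /=; lra.
Qed.

Lemma quat_mx_trl p :
  (quat_mx p)^T *m quat_mx p = (quat_norm +%R *%R p)%:M.
Proof.
case: p => [[[a b] c] d].
apply/matrixP => i j; rewrite !mxE !big_ord_recl big_ord0 !mxE /=.
by case: i => [[|[|[|[|//]]]] ?]; case: j => [[|[|[|[|//]]]] ?] /=; lra.
Qed.

Lemma quat_mx_trr p :
  quat_mx p *m (quat_mx p)^T = (quat_norm +%R *%R p)%:M.
Proof.
case: p => [[[a b] c] d].
apply/matrixP => i j; rewrite !mxE !big_ord_recl big_ord0 !mxE /=.
by case: i => [[|[|[|[|//]]]] ?]; case: j => [[|[|[|[|//]]]] ?] /=; lra.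
Qed.

(** Multiplication by a quaternion of nonzero norm is injective, and for a unit [p] of real part [a]
    the norm of [p - 1] is [2 - 2 a]. *)
Lemma quat_mx_fixed p (u : 'cV[R]_4) :
  quat_norm +%R *%R p = 1 -> p.1.1.1 != 1 -> quat_mx p *m u = u -> u = 0.
Proof.
case: p => [[[a b] c] d] /= p1 a1 fix_u.
pose q : quat R := (a - 1, b, c, d).
have qE : quat_mx q = quat_mx (a, b, c, d) - 1%:M.
  apply/matrixP => i j; rewrite !mxE.
  by case: i => [[|[|[|[|//]]]] ?]; case: j => [[|[|[|[|//]]]] ?] /=; lra.
have /(congr1 (mulmx (quat_mx q)^T)) : quat_mx q *m u = 0.
  by rewrite qE mulmxBl fix_u mul1mx subrr.
rewrite mulmxA quat_mx_trl mulmx0 mul_scalar_mx => /eqP.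
rewrite scaler_eq0 => /orP[/eqP /= q0|/eqP //].
by case/eqP: a1; lra.
Qed.

End QuaternionMatrix.

(* The pair [(m, n)] stands for [m + n phi], with [phi] the golden ratio. *)
Definition zphi : Type := (int * int)%type.
Definition zphi_add (x y : zphi) : zphi := (x.1 + y.1, x.2 + y.2).
Definition zphi_sub (x y : zphi) : zphi := (x.1 - y.1, x.2 - y.2).
Definition zphi_mul (x y : zphi) : zphi :=
  (x.1 * y.1 + x.2 * y.2, x.1 * y.2 + x.2 * y.1 + x.2 * y.2).
(** The field norm of [m + n phi]: its product with the conjugate [m + n (1 - phi)]. *)
Definition zphi_norm (x : zphi) : int :=
  x.1 * x.1 + x.1 * x.2 - x.2 * x.2.

Definition icosian_mul : quat zphi -> quat zphi -> quat zphi :=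
  quat_mul zphi_add zphi_sub zphi_mul.

(** Stored icosians carry a factor 2, so the product of two of them is twice the stored form of the
    product. *)
Definition icosian_double : quat zphi -> quat zphi :=
  quat_map (fun x => zphi_add x x).

(* The 120 unit icosians, all multiplied by 2 in order to be integral; twelve
   rounds of multiplication by the generators reach all of them. *)
Definition icosians : seq (quat zphi) :=
  let s : quat zphi := ((1, 0), (1, 0), (1, 0), (1, 0)) in
  let t : quat zphi := ((0, 1), (1, 0), (-1, 1), (0, 0)) in
  let half_mul p q :=
    quat_map (fun x => ((x.1 %/ 2)%Z, (x.2 %/ 2)%Z)) (icosian_mul p q) in
  let extend l := undup (l ++ map (half_mul s) l ++ map (half_mul t) l) in
  iter 12 extend [:: ((2, 0), (0, 0), (0, 0), (0, 0))].

Definition mx_key : Type := (nat * nat * nat * nat)%type.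

Definition mx_key_mul (k l : mx_key) : mx_key :=
  let: (a, b, c, d) := k in let: (x, y, z, t) := l in
  ((a * x + b * z) %% 5, (a * y + b * t) %% 5,
   (c * x + d * z) %% 5, (c * y + d * t) %% 5)%N.

(* Reduction modulo [sqrt 5], where [phi] becomes 3; the quaternions [i] and [j]
   go to [[2, 0], [0, -2]] and [[0, 1], [-1, 0]]. *)
Definition icosian_key (p : quat zphi) : mx_key :=
  let: (a, b, c, d) :=
    quat_map (fun x => `|((x.1 + 3 * x.2) * 3) %% 5|%Z%N) p in
  ((a + 2 * b) %% 5, (c + 2 * d) %% 5, (4 * c + 2 * d) %% 5,
   (a + 3 * b) %% 5)%N.

(** Evaluated once, so that each lookup searches an explicit list. *)
Definition icosian_table : seq (mx_key * quat zphi) :=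
  Eval vm_compute in [seq (icosian_key p, p) | p <- icosians].

(** A section of the reduction, by table lookup. A missing key would give the zero quaternion, which
    [icosian_of_unit] excludes on [SL2_5_keys]. *)
Definition icosian_of (k : mx_key) : quat zphi :=
  (nth (k, ((0, 0), (0, 0), (0, 0), (0, 0)))
     icosian_table (find (fun x => x.1 == k) icosian_table)).2.

(** Here [4 * (b * c)] represents [- b * c] modulo 5. *)
Definition SL2_5_keys : seq mx_key :=
  [seq k <- [seq (x.1, x.2, y.1, y.2) |
               x <- [seq (a, b) | a <- iota 0 5, b <- iota 0 5],
               y <- [seq (c, d) | c <- iota 0 5, d <- iota 0 5]] |
     let: (a, b, c, d) := k in ((a * d + 4 * (b * c)) %% 5 == 1)%N].

(** Reduction modulo [sqrt 5] identifies the unit icosians with SL_2(5). That the inverse map is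
    multiplicative is a finite check over all pairs of keys. *)
Lemma icosian_ofM :
  all (fun k => all (fun l =>
    icosian_mul (icosian_of k) (icosian_of l) ==
    icosian_double (icosian_of (mx_key_mul k l))) SL2_5_keys) SL2_5_keys.
Proof. by vm_compute. Qed.

Lemma icosian_of_unit :
  all (fun k =>
    quat_norm zphi_add zphi_mul (icosian_of k) == (4, 0)) SL2_5_keys.
Proof. by vm_compute. Qed.

(** The integer norm makes it decidable that a real part differs from 1, stored as [(2, 0)];
    [zphi_val_eq0] carries this over to the reals. *)
Lemma icosian_of_neq1 :
  all (fun k => (k == (1, 0, 0, 1)%N) ||
    (zphi_norm (zphi_sub (icosian_of k).1.1.1 (2, 0)) != 0)) SL2_5_keys.
Proof. by vm_compute. Qed.

(** * Encoding of SL_2(5) by quadruples of residues *)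

Definition mx_key_of (g : {'GL_2(5)}) : mx_key :=
  let A := GLval g in
  (A 0 0 : nat, A 0 1 : nat, A 1 0 : nat, A 1 1 : nat).

Lemma mx_key_ofM g h :
  mx_key_of (g * h)%g = mx_key_mul (mx_key_of g) (mx_key_of h).
Proof.
rewrite /mx_key_of /mx_key_mul GL_ME !mxE !big_ord_recl !big_ord0 !addr0.
have -> : fintype.lift ord0 ord0 = 1 :> 'I_2 by exact: val_inj.
have valD (x y : 'F_5) :
  nat_of_ord (x + y) = ((nat_of_ord x + nat_of_ord y) %% 5)%N by [].
have valM (x y : 'F_5) :
  nat_of_ord (x * y) = ((nat_of_ord x * nat_of_ord y) %% 5)%N by [].
by rewrite !valD !valM !modnDm.
Qed.

Lemma mx_key_of1 : mx_key_of 1%g = (1, 0, 0, 1)%N.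
Proof. by rewrite /mx_key_of GL_1E !mxE. Qed.

Lemma mx_key_of_inj : injective mx_key_of.
Proof.
move=> g h [e00 e01 e10 e11]; apply: val_inj; apply/matrixP => i j /=.
have ord2 (k : 'I_2) : k = 0 \/ k = 1.
  by case: k => [[|[|//]] ?]; [left|right]; exact: val_inj.
by apply: ord_inj; case: (ord2 i) (ord2 j) => -> [] ->.
Qed.


Lemma det_mx22 (K : comNzRingType) (A : 'M[K]_2) :
  \det A = A 0 0 * A 1 1 - A 0 1 * A 1 0.
Proof.
have l0 : fintype.lift 0 0 = 1 :> 'I_2 by exact: val_inj.
have l1 : fintype.lift 1 0 = 0 :> 'I_2 by exact: val_inj.
rewrite (expand_det_row _ 0) !big_ord_recl big_ord0 addr0 l0 /cofactor.
by rewrite !det_mx11 !mxE l0 l1 /= expr0 expr1 mul1r mulN1r mulrN.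
Qed.

Lemma mem_SL2_5_keys g : g \in SL2_5 -> mx_key_of g \in SL2_5_keys.
Proof.
rewrite inE det_mx22 => /eqP det_g.
have valD (x y : 'F_5) :
  nat_of_ord (x + y) = ((nat_of_ord x + nat_of_ord y) %% 5)%N by [].
have valM (x y : 'F_5) :
  nat_of_ord (x * y) = ((nat_of_ord x * nat_of_ord y) %% 5)%N by [].
rewrite mem_filter; apply/andP; split.
  have := congr1 (@nat_of_ord _) det_g; rewrite /mx_key_of.
  have -> : forall x : 'F_5, - x = 4%:R * x.
    move=> x; apply/esym/eqP; rewrite -subr_eq0 opprK -[x in _ + x]mul1r.
    by rewrite -mulrDl (_ : _ + 1 = 0) ?mul0r//; exact: val_inj.
  rewrite valD !valM => e.
  apply/eqP; rewrite -modnDm -[(4 * _ %% _)%N]modnMmr; exact: e.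
have lt5 (x : 'F_5) : (x : nat) \in iota 0 5.
  by rewrite mem_iota; exact: ltn_ord.
pose pairs := [seq (a, b) | a <- iota 0 5, b <- iota 0 5].
have mem_pairs (x y : 'F_5) : (x : nat, y : nat) \in pairs.
  by apply/allpairsPdep; exists (x : nat), (y : nat).
apply/allpairsPdep; exists (GLval g 0 0 : nat, GLval g 0 1 : nat).
by exists (GLval g 1 0 : nat, GLval g 1 1 : nat).
Qed.

(** * The free representation of SL_2(5) in SO(8) *)

Section Representation.
Variable R : realType.

Definition golden : R := (1 + Num.sqrt 5) / 2.

Lemma golden_sqr : golden * golden = golden + 1.
Proof.
have := @sqr_sqrtr R 5 (ler0n _ 5); rewrite /golden expr2.
by set s := Num.sqrt _ => hs; lra.
Qed.

Definition zphi_val (x : zphi) : R := x.1%:~R + x.2%:~R * golden.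

Lemma zphi_valD x y : zphi_val (zphi_add x y) = zphi_val x + zphi_val y.
Proof. by rewrite /zphi_val !intrD; lra. Qed.

Lemma zphi_valB x y : zphi_val (zphi_sub x y) = zphi_val x - zphi_val y.
Proof. by rewrite /zphi_val !intrB; lra. Qed.

Lemma zphi_valM x y : zphi_val (zphi_mul x y) = zphi_val x * zphi_val y.
Proof.
(* The relation [phi^2 = phi + 1] enters multiplied by [x.2 * y.2], after which the identity is
   linear in the monomials. *)
have := congr1 (fun z => x.2%:~R * y.2%:~R * z) golden_sqr.
by rewrite /zphi_val !(intrD, intrM); lra.
Qed.

(** The norm is the product of [zphi_val x] with its conjugate, where [1 - golden] replaces
    [golden], so it vanishes when [zphi_val x] does. *)
Lemma zphi_val_eq0 x : zphi_norm x != 0 -> zphi_val x != 0.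
Proof.
apply: contra_neq => x0.
have := congr1 (fun z => z * (x.1%:~R + x.2%:~R * (1 - golden))) x0.
have := congr1 (fun z => x.2%:~R * x.2%:~R * z) golden_sqr.
rewrite mul0r /zphi_val => e1 e2; apply: (@intr_inj R).
by rewrite /zphi_norm !(intrD, intrN, intrM) /=; lra.
Qed.

Definition icosian_val (p : quat zphi) : quat R :=
  quat_map (fun x => zphi_val x / 2) p.

Definition icosian_mx (g : {'GL_2(5)}) : 'M[R]_4 :=
  quat_mx (icosian_val (icosian_of (mx_key_of g))).

Lemma icosian_mxM :
  {in SL2_5 &, {morph icosian_mx : g h / (g * h)%g >-> g *m h}}.
Proof.
move=> g h /mem_SL2_5_keys gK /mem_SL2_5_keys hK.
rewrite /icosian_mx quat_mxM mx_key_ofM; congr quat_mx.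
have /allP/(_ _ gK)/allP/(_ _ hK)/eqP := icosian_ofM.
move: (icosian_of _) (icosian_of _) (icosian_of _) => r p q.
move=> e.
have e1 := congr1 (fun r => zphi_val r.1.1.1) e.
have e2 := congr1 (fun r => zphi_val r.1.1.2) e.
have e3 := congr1 (fun r => zphi_val r.1.2) e.
have e4 := congr1 (fun r => zphi_val r.2) e.
case: p q r e1 e2 e3 e4 {e} => [[[a b] c] d] [[[x y] z] t] [[[u v] w] s] /=.
rewrite !(zphi_valD, zphi_valB, zphi_valM) /= => e1 e2 e3 e4.
by congr (_, _, _, _); lra.
Qed.

Lemma icosian_mx1 : icosian_mx 1%g = 1%:M.
Proof.
rewrite /icosian_mx mx_key_of1.
have -> : icosian_of (1, 0, 0, 1)%N = ((2, 0), (0, 0), (0, 0), (0, 0)) by [].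
apply/matrixP => i j; rewrite !mxE /= /zphi_val /=.
by case: i => [[|[|[|[|//]]]] ?]; case: j => [[|[|[|[|//]]]] ?] /=; lra.
Qed.

Lemma icosian_norm g : g \in SL2_5 ->
  quat_norm +%R *%R (icosian_val (icosian_of (mx_key_of g))) = 1.
Proof.
move=> /mem_SL2_5_keys gK; have /allP/(_ _ gK)/eqP := icosian_of_unit.
move: (icosian_of _) => [[[a b] c] d] /(congr1 zphi_val).
rewrite !(zphi_valD, zphi_valM) [zphi_val (4, 0)]/zphi_val /=; lra.
Qed.

Lemma icosian_mx_fixed g (u : 'cV[R]_4) :
  g \in SL2_5 -> g != 1%g -> icosian_mx g *m u = u -> u = 0.
Proof.
move=> gG g1; apply: quat_mx_fixed; first exact: icosian_norm.
have /allP/(_ _ (mem_SL2_5_keys gG)) := icosian_of_neq1.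
rewrite -mx_key_of1 (inj_eq mx_key_of_inj) (negPf g1) /= => /zphi_val_eq0.
move: (icosian_of _) => [[[a b] c] d].
rewrite zphi_valB [zphi_val (2, 0)]/zphi_val /=.
by apply: contra_neq; lra.
Qed.

Definition icosian_rep_mx (g : {'GL_2(5)}) : 'M[R]_8 :=
  block_mx (icosian_mx g) 0 0 (icosian_mx g) : 'M_(4 + 4).

Lemma icosian_rep_subproof : mx_repr SL2_5 icosian_rep_mx.
Proof.
split=> [|g h gG hG].
  by rewrite /icosian_rep_mx icosian_mx1; exact: esym (scalar_mx_block 4 4 1).
rewrite /icosian_rep_mx icosian_mxM //.
by rewrite (@mulmx_block _ 4 4 4 4 4 4) !mulmx0 !mul0mx !addr0 add0r.
Qed.

Definition icosian_rep : mx_representation R SL2_5 8 :=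
  MxRepresentation icosian_rep_subproof.

(** For two equal orthogonal blocks [A] the determinant is [det A * det A^T = det (A A^T) = 1],
    whatever the sign of [det A]. *)
Lemma icosian_rep_SO g : g \in SL2_5 -> SO (icosian_rep g).
Proof.
move=> gG; rewrite /SO /=.
have orth : icosian_mx g *m (icosian_mx g)^T = 1%:M.
  by rewrite quat_mx_trr icosian_norm.
split.
  rewrite /icosian_rep_mx (@tr_block_mx _ 4 4 4 4) (@mulmx_block _ 4 4 4 4 4 4).
  rewrite !trmx0 !mulmx0 !mul0mx !addr0 add0r orth.
  exact: esym (scalar_mx_block 4 4 1).
rewrite /icosian_rep_mx (@det_ublock _ 4 4).
by rewrite -[X in _ * X]det_tr -det_mulmx orth det1.
Qed.

Lemma icosian_rep_fixed g (u : 'cV[R]_8) :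
  g \in SL2_5 -> g != 1%g -> icosian_rep g *m u = u -> u = 0.
Proof.
move=> gG g1; rewrite /= /icosian_rep_mx -[u](@vsubmxK _ 4 4).
rewrite (@mul_block_col _ 4 4 4 4 1).
rewrite !mul0mx addr0 add0r => /(@eq_col_mx _ 4 4) [eu ed].
rewrite (icosian_mx_fixed gG g1 eu) (icosian_mx_fixed gG g1 ed).
exact: (@col_mx0 _ 4 4).
Qed.

End Representation.

(** * Counting cells on the sphere *)

Section VectorNorm.
Variable R : realType.

Lemma cV_norm_le n (v : 'cV[R]_n) e :
  0 <= e -> (forall i, `|v i 0| <= e) -> `|v| <= e.
Proof.
move=> e0 ve; rewrite [leLHS]/Num.Def.normr /= mx_normrE.
by apply: bigmax_le => // -[i j] _ /=; rewrite (ord1 j).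
Qed.

Lemma cV_coord_le n (v : 'cV[R]_n) i : `|v i 0| <= `|v|.
Proof.
rewrite [leRHS]/Num.Def.normr /= mx_normrE.
exact: (le_bigmax _ (fun ij : 'I_n * 'I_1 => `|v ij.1 ij.2|) (i, 0)).
Qed.

Lemma mulmx_norm_le m n (A : 'M[R]_(m, n)) (v : 'cV[R]_n) :
  `|A *m v| <= (\sum_i \sum_j `|A i j|) * `|v|.
Proof.
apply: cV_norm_le => [|i].
  by rewrite mulr_ge0 ?sumr_ge0// => i _; exact: sumr_ge0.
rewrite mxE (le_trans (ler_norm_sum _ _ _))// (bigD1 i)//= mulrDl ler_wpDr//.
  by rewrite mulr_ge0 ?sumr_ge0// => k _; exact: sumr_ge0.
rewrite mulr_suml ler_sum// => j _.
by rewrite normrM ler_wpM2l//; exact: cV_coord_le.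
Qed.

End VectorNorm.

Section Sphere.
Variable R : realType.
Local Notation X := (sphere R 3).

Lemma sphere_sum (x : X) : \sum_i (val x : 'cV[R]_4) i 0 ^+ 2 = 1.
Proof. by have := set_mem (valP x). Qed.

Lemma sphere_coord_le (x : X) i : `|val x i 0| <= 1.
Proof.
have : val x i 0 ^+ 2 <= 1 :> R.
  rewrite -(sphere_sum x) (bigD1 i)//= lerDl.
  by apply: sumr_ge0 => k _; exact: sqr_ge0.
by rewrite ler_norml expr2; nra.
Qed.

Lemma sphere_big_coord (x : X) : exists i, 1 / 2 <= `|val x i 0|.
Proof.
apply: contrapT => /forallNP small; have := sphere_sum x.
suff : \sum_i (val x : 'cV[R]_4) i 0 ^+ 2 < 1 by move=> /lt_eqF/eqP.
have lt i : val x i 0 ^+ 2 < 1 / 4 :> R.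
  have /negP := small i; rewrite -ltNge => lt2.
  rewrite -real_normK ?num_real// expr2.
  have := normr_ge0 (val x i 0); nra.
rewrite !big_ord_recl big_ord0.
move: (lt 0) (lt (fintype.lift 0 0)) (lt (fintype.lift 0 (fintype.lift 0 0))).
by move: (lt (fintype.lift 0 (fintype.lift 0 (fintype.lift 0 0)))); lra.
Qed.

(* An index [i] with [|x i| >= 1/2], the sign of [x i], and the other three
   coordinates rounded: on such a piece [x i] is a Lipschitz function of them. *)
Definition sphere_cell N : finType :=
  ('I_4 * bool * {ffun 'I_3 -> 'I_(2 * N).+1})%type.

(** In one cell the three rounded coordinates agree up to [1 / N], hence their squares up to
    [2 / N]. As the squares sum to 1, those of the remaining coordinate agree up to [6 / N];
    dividing by [|x i + y i| >= 1] gives the bound, because both terms have the same sign and size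
    at least 1/2. *)
Lemma sphere_cells N : (0 < N)%N -> exists cell : X -> sphere_cell N,
  forall x y, cell x = cell y -> `|val x - val y| <= 6 / N%:R.
Proof.
move=> N0; have N0R : (0 : R) < N%:R by rewrite ltr0n.
have [big bigP] := choice sphere_big_coord.
(* Maps [[-1, 1]] onto [[0, 2 N]], whose integer parts take [2 N + 1] values. *)
pose h (x : X) j : R := (val x j 0 + 1) * N%:R.
pose cell x : sphere_cell N :=
  (big x, 0 <= val x (big x) 0,
   [ffun k => inord (Num.trunc (h x (fintype.lift (big x) k)))]).
have h_ge0 x j : 0 <= h x j.
  have := sphere_coord_le x j; rewrite ler_norml /h => /andP[? ?].
  by rewrite mulr_ge0 ?ler0n//; lra.
have h_le x j : (Num.trunc (h x j) < (2 * N).+1)%N.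
  rewrite truncn_lt_nat// -natr1 natrM ltr_pwDr//.
  have := sphere_coord_le x j; rewrite ler_norml /h => /andP[? ?].
  by rewrite ler_pM2r//; lra.
exists cell => x y [ebig esign /ffunP ecoord].
have close_lift k :
    `|val x (fintype.lift (big x) k) 0 - val y (fintype.lift (big x) k) 0|
      <= N%:R^-1.
  have := congr1 (@nat_of_ord _) (ecoord k); rewrite !ffunE -ebig !inordK//.
  set j := fintype.lift _ _ => e.
  have := trunc_itv (h_ge0 x j); have := trunc_itv (h_ge0 y j).
  rewrite e -natr1 => /andP[y1 y2] /andP[x1 x2].
  rewrite -(ler_pM2r N0R) mulVf ?gt_eqF// -[X in _ * X <= _](gtr0_norm N0R).
  rewrite -normrM ler_norml.
  by move: x1 x2 y1 y2; rewrite /h; lra.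
have N6 : N%:R^-1 <= 6 / N%:R :> R by rewrite ler_peMl ?invr_ge0 ?ler0n//; lra.
apply: cV_norm_le => [|j]; first by rewrite divr_ge0 ?ler0n.
rewrite !mxE; case: (unliftP (big x) j) => [k ->|->].
  exact: le_trans (close_lift k) N6.
set i := big x.
have sq_close k :
    `|val x (fintype.lift i k) 0 ^+ 2 - val y (fintype.lift i k) 0 ^+ 2|
      <= 2 / N%:R.
  rewrite subr_sqr normrM [leRHS]mulrC ler_pM//.
  rewrite (le_trans (ler_normD _ _))//.
  have := sphere_coord_le x (fintype.lift i k).
  by have := sphere_coord_le y (fintype.lift i k); lra.
have sq : `|val x i 0 ^+ 2 - val y i 0 ^+ 2| <= 6 / N%:R.
  have := sphere_sum x; have := sphere_sum y.
  rewrite !(bigD1_ord i) //= !big_ord_recl !big_ord0.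
  move: (sq_close 0) (sq_close (fintype.lift 0 0)).
  move: (sq_close (fintype.lift 0 (fintype.lift 0 0))).
  by rewrite !ler_norml; lra.
apply: le_trans sq; rewrite subr_sqr normrM ler_peMr//.
have := bigP y; rewrite -ebig -/i; have := bigP x; rewrite -/i.
move: esign; rewrite -ebig -/i.
case: (lerP 0 (val x i 0)) => [x0 /esym y0|x0 /esym/negbT].
  by rewrite !ger0_norm ?addr_ge0//; lra.
rewrite -ltNge => y0; rewrite !ltr0_norm//; lra.
Qed.

(** Each rounded coordinate takes [2 N + 1 <= 3 N] values; the exponent 3 is the dimension of the
    sphere. *)
Lemma card_sphere_cell : exists c, forall N, (0 < N)%N ->
  (#|{: sphere_cell N}| <= c * N ^ 3)%N.
Proof.
exists (4 * 2 * 3 ^ 3)%N => N N0.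
rewrite !card_prod card_bool card_ffun !card_ord -[leqRHS]mulnA -expnMn.
by rewrite leq_mul2l/= leq_exp2r// (mulSn 2) addnC -addn1 leq_add2l.
Qed.

End Sphere.

(** * Translating a Lipschitz image off the cone over another *)

Section Avoid.
Variable R : realType.
Local Notation X := (sphere R 3).

Lemma natr_close_eq (a b : nat) : `|(a%:R : R) - b%:R| < 1 -> a = b.
Proof.
rewrite ltr_norml; case: (ltngtP a b) => // ab.
  have : (a.+1%:R : R) <= b%:R by rewrite ler_nat.
  by rewrite -natr1 => ? /andP[? ?]; exfalso; lra.
have : (b.+1%:R : R) <= a%:R by rewrite ler_nat.
by rewrite -natr1 => ? /andP[? ?]; exfalso; lra.
Qed.

(* Cut the domain of [(x, y, c)] into [O(N ^ 7)] cells of size [O(1 / N)]. On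
   each cell [c *: P y - P x] varies by [r = O(1 / N)], hence is close to at most
   one of the [T ^ 8] points of a grid of mesh [4 * r] in the ball of radius [e];
   the choice of [T], of order [N], leaves a grid point that is close to none. *)
Lemma avoid_cone (P : X -> 'cV[R]_8) L M e :
  0 <= L -> 0 < M -> 0 < e ->
  (forall x y, `|P x - P y| <= L * `|val x - val y|) ->
  (forall x, `|P x| <= M) ->
  exists2 w, `|w| <= e & exists2 m, 0 < m &
    forall x y c, 0 <= c <= 1 -> m <= `|P x + w - c *: P y|.
Proof.
move=> L0 M0 e0 lipP PM.
(* Within a cell, [x] and [y] each move by at most [6 / N] and [c] by at most [1 / N], so
   [c *: P y - P x] varies by at most [D / N]. *)
pose D := 12 * L + M; have D0 : 0 < D by rewrite /D; lra.
(* With [N = T * J], the side [T * (4 * r)] of the grid is [4 * D / J], which this choice of [J]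
   makes at most [e]. *)
pose J := (Num.trunc (4 * D / e)).+1.
have J0 : (0 : R) < J%:R by rewrite ltr0n.
have JD : 4 * D / e <= J%:R.
  have De : 0 <= 4 * D / e by rewrite divr_ge0 ?mulr_ge0 ?(ltW D0) ?(ltW e0).
  by apply: ltW; have /andP[] := trunc_itv De.
have [b cardb] := card_sphere_cell.
(* There are at most [K * N ^ 7 = (K * J ^ 7) * T ^ 7] cells, fewer than the [T ^ 8] grid points
   because [T] exceeds [K * J ^ 7]. *)
pose K := (b * b * 2)%N; pose T := (K * J ^ 7).+1; pose N := (T * J)%N.
have N0 : (0 < N)%N by rewrite muln_gt0.
have N0R : (0 : R) < N%:R by rewrite ltr0n.
pose r := D / N%:R; have r0 : 0 < r by rewrite divr_gt0.
pose w (k : {ffun 'I_8 -> 'I_T}) : 'cV[R]_8 := \col_i ((k i)%:R * (4 * r)).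
have w_le k : `|w k| <= e.
  apply: cV_norm_le => [|i]; first exact: ltW.
  have r4 : 0 <= 4 * r by lra.
  rewrite mxE ger0_norm; last exact: (mulr_ge0 (ler0n _ _) r4).
  apply: (@le_trans _ _ (T%:R * (4 * r))).
    by rewrite ler_wpM2r ?ler_nat ?(ltnW (ltn_ord _))//; lra.
  rewrite /r /N natrM.
  rewrite (_ : T%:R * _ = 4 * D / J%:R); last first.
    have TV : T%:R * T%:R^-1 = 1 :> R by rewrite mulfV// pnatr_eq0.
    have := congr1 (fun z => z * (4 * D * J%:R^-1)) TV.
    by rewrite invfM; lra.
  by rewrite ler_pdivrMr// [leRHS]mulrC -ler_pdivrMr.
have [[k wP]|near] := pselect (exists k, forall x y c, 0 <= c <= 1 ->
    r <= `|P x + w k - c *: P y|); first by exists (w k) => //; exists r.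
have /choice[t tP] : forall k, exists t : X * X * R,
    0 <= t.2 <= 1 /\ `|P t.1.1 + w k - t.2 *: P t.1.2| < r.
  move=> k.
  apply: contrapT => /forallNP far; apply: near; exists k => x y c c01.
  by rewrite leNgt; apply/negP => lt; apply: (far (x, y, c)).
have [cell cellP] := sphere_cells R N0.
pose code k := (cell (t k).1.1, cell (t k).1.2,
                inord (Num.trunc ((t k).2 * N%:R)) : 'I_N.+1).
(* If every grid point were hit within [r], two of them with hits in the same cell would be less
   than [r + r + r] apart, which is below the mesh, and so would coincide. *)
have code_inj : injective code.
  move=> k k' [/cellP]; have [/andP[c0 c1] tk] := tP k.
  have [/andP[c0' c1'] tk'] := tP k'.
  set x := (t k).1.1 in tk *; set x' := (t k').1.1 in tk' *.
  set y := (t k).1.2 in tk *; set y' := (t k').1.2 in tk' *.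
  set c := (t k).2 in c0 c1 tk *; set c' := (t k').2 in c0' c1' tk' *.
  move=> xx' /cellP yy' /(congr1 (@nat_of_ord _)).
  have trunc_lt (u : R) : 0 <= u -> u <= 1 -> (Num.trunc (u * N%:R) < N.+1)%N.
    move=> u0 u1; rewrite truncn_lt_nat ?mulr_ge0 ?ler0n//.
    by rewrite -natr1 ltr_pwDr// ler_piMl ?ler0n.
  rewrite !inordK ?trunc_lt// => ecc'.
  have cc' : `|c - c'| <= 1 / N%:R.
    have := trunc_itv (mulr_ge0 c0 (ltW N0R)).
    have := trunc_itv (mulr_ge0 c0' (ltW N0R)).
    rewrite ecc' -natr1 ler_pdivlMr// -[X in _ * X <= _](gtr0_norm N0R).
    by rewrite -normrM ler_norml; clear; lra.
  have wE : w k - w k' = (P x + w k - c *: P y) - (P x' + w k' - c' *: P y') -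
      (P x - P x') + (c *: (P y - P y') + (c - c') *: P y').
    by apply/matrixP => i j; rewrite !mxE; clear; lra.
  have {wE} w_lt : `|w k - w k'| < 4 * r.
    rewrite wE.
    apply: le_lt_trans (ler_normD _ _) _.
    apply: le_lt_trans (lerD (ler_normB _ _) (ler_normD _ _)) _.
    apply: le_lt_trans (lerD (lerD (ler_normB _ _) (lexx _)) (lexx _)) _.
    rewrite !normrZ (ger0_norm c0).
    have h1 := le_trans (lipP x x') (ler_wpM2l L0 xx').
    have h2 := le_trans (lipP y y') (ler_wpM2l L0 yy').
    have h3 : c * `|P y - P y'| <= L * (6 / N%:R).
      by apply: le_trans h2; rewrite ler_piMl.
    have h4 : `|c - c'| * `|P y'| <= 1 / N%:R * M by rewrite ler_pM.
    have rE : r = L * (6 / N%:R) + L * (6 / N%:R) + 1 / N%:R * M.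
      by rewrite /r /D; clear; lra.
    by move: tk tk' h1 h3 h4 rE r0; clear; lra.
  apply/ffunP => i; apply: ord_inj; apply: natr_close_eq.
  have := le_lt_trans (cV_coord_le (w k - w k') i) w_lt.
  have r4 : 0 < 4 * r by rewrite mulr_gt0.
  by rewrite !mxE -mulrBl normrM (gtr0_norm r4) gtr_pMl.
have := leq_card code code_inj.
rewrite card_ffun !card_ord 2!card_prod card_ord leqNgt => /negP[].
apply: (@leq_ltn_trans (K * N ^ 7)).
  have cN := cardb N N0.
  have N2 : (N.+1 <= 2 * N)%N by rewrite mul2n -addnn -addn1 leq_add2l.
  apply: leq_trans (leq_mul (leq_mul cN cN) N2) _.
  by rewrite (mulnACA b) -expnD (mulnACA (b * b)) -expnSr.
rewrite /N expnMn (mulnC (T ^ 7)%N) mulnA (expnSr T 7) mulnC.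
by rewrite ltn_pmul2l ?expn_gt0.
Qed.
End Avoid.

(** * Generic equivariant maps *)

Section UniformContinuity.
Variable R : realType.
Local Notation X := (sphere R 3).

Definition unif_cont (V : normedZmodType R) (F : X -> V) : Prop :=
  forall e, 0 < e -> exists2 d, 0 < d &
    forall x y, `|val x - val y| < d -> `|F x - F y| <= e.

Definition bounded_map (V : normedZmodType R) (F : X -> V) : Prop :=
  exists2 M, 0 < M & forall x, `|F x| <= M.

Lemma lipschitz_unif_cont (V : normedZmodType R) (F : X -> V) L :
  (forall x y, `|F x - F y| <= L * `|val x - val y|) -> unif_cont F.
Proof.
move=> lipF e e0; exists (e / (`|L| + 1)); first by rewrite divr_gt0// ltr_wpDl.
move=> x y; rewrite ltr_pdivlMr ?ltr_wpDl// => lt; apply: le_trans (lipF x y) _.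
have := ler_norm L; have := normr_ge0 (val x - val y); nra.
Qed.

Lemma unif_contD (V : normedZmodType R) (F H : X -> V) :
  unif_cont F -> unif_cont H -> unif_cont (fun x => F x + H x).
Proof.
move=> ucF ucH e e0; have e2 : 0 < e / 2 by lra.
have [d1 d10 h1] := ucF _ e2; have [d2 d20 h2] := ucH _ e2.
exists (Num.min d1 d2); first by rewrite lt_min d10.
move=> x y; rewrite lt_min => /andP[/h1 Fxy /h2 Hxy].
rewrite opprD addrACA (le_trans (ler_normD _ _))//; lra.
Qed.

Lemma unif_contN (V : normedZmodType R) (F : X -> V) :
  unif_cont F -> unif_cont (fun x => - F x).
Proof.
move=> ucF e /ucF[d d0 h]; exists d => // x y /h.
by rewrite -opprD normrN.
Qed.

Lemma unif_cont_cst (V : normedZmodType R) (v : V) : unif_cont (fun _ => v).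
Proof. by move=> e e0; exists 1 => // x y _; rewrite subrr normr0 ltW. Qed.

Lemma unif_cont_sum (V : normedZmodType R) (I : Type) (r : seq I) (P : pred I)
    (F : I -> X -> V) :
  (forall i, P i -> unif_cont (F i)) ->
  unif_cont (fun x => \sum_(i <- r | P i) F i x).
Proof.
move=> ucF; elim: r => [|i r IH].
  rewrite (_ : (fun x => _) = fun=> 0); first exact: unif_cont_cst.
  by apply/funext => x; rewrite big_nil.
case Pi : (P i).
  rewrite (_ : (fun x => _) = fun x => F i x + \sum_(j <- r | P j) F j x).
    by apply: unif_contD => //; exact: ucF.
  by apply/funext => x; rewrite big_cons Pi.
rewrite (_ : (fun x => _) = fun x => \sum_(j <- r | P j) F j x) //.
by apply/funext => x; rewrite big_cons Pi.
Qed.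

Lemma unif_cont_comp (V : normedZmodType R) (F : X -> V) (f : X -> X) :
  unif_cont F -> unif_cont (fun x => val (f x)) -> unif_cont (fun x => F (f x)).
Proof.
move=> ucF ucf e /ucF[d d0 hF].
have /ucf[d' d'0 hf] : 0 < d / 2 by lra.
by exists d' => // x y /hf fxy; apply: hF; lra.
Qed.

Lemma unif_contZ (V : normedModType R) (u : X -> R) (F : X -> V) :
  unif_cont u -> bounded_map u -> unif_cont F -> bounded_map F ->
  unif_cont (fun x => u x *: F x).
Proof.
move=> ucu [B B0 uB] ucF [M M0 FM] e e0.
have /ucu[d1 d10 h1] : 0 < e / 2 / M by rewrite !divr_gt0.
have /ucF[d2 d20 h2] : 0 < e / 2 / B by rewrite !divr_gt0.
exists (Num.min d1 d2); first by rewrite lt_min d10.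
move=> x y; rewrite lt_min => /andP[/h1 uxy /h2 Fxy].
rewrite (_ : _ - _ = (u x - u y) *: F x + u y *: (F x - F y)); last first.
  by rewrite scalerBl scalerBr addrA subrK.
rewrite (le_trans (ler_normD _ _))// !normrZ.
rewrite (_ : e = e / 2 / M * M + B * (e / 2 / B)); last first.
  by rewrite divfK ?gt_eqF// [B * _]mulrC divfK ?gt_eqF//; lra.
by rewrite lerD// ler_pM.
Qed.

Lemma unif_cont_mulmx m n (A : 'M[R]_(m, n)) (F : X -> 'cV[R]_n) :
  unif_cont F -> unif_cont (fun x => A *m F x).
Proof.
move=> ucF e e0; set B := \sum_i \sum_j `|A i j|.
have B0 : 0 <= B by apply: sumr_ge0 => i _; exact: sumr_ge0.
have B1 : 0 < B + 1 by lra.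
have /ucF[d d0 h] : 0 < e / (B + 1) by rewrite divr_gt0.
exists d => // x y /h; rewrite ler_pdivlMr// => Fxy.
rewrite -mulmxBr (le_trans (mulmx_norm_le _ _))// -/B.
have := normr_ge0 (F x - F y); nra.
Qed.

Lemma bounded_mapD (V : normedZmodType R) (F H : X -> V) :
  bounded_map F -> bounded_map H -> bounded_map (fun x => F x + H x).
Proof.
move=> [B B0 uB] [M M0 FM]; exists (B + M); first exact: addr_gt0.
by move=> x; rewrite (le_trans (ler_normD _ _))// lerD.
Qed.

(* Inf-convolution: [P x = inf_y (F y + L |x - y|)] coordinatewise. *)
Lemma lipschitz_approx n (F : X -> 'cV[R]_n) e :
  unif_cont F -> bounded_map F -> 0 < e ->
  exists P L, [/\ 0 <= L, forall x y, `|P x - P y| <= L * `|val x - val y|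
                & forall x, `|P x - F x| <= e].
Proof.
move=> ucF [M M0 FM] e0; have [d d0 hF] := ucF e e0.
(* At distance at least [d] the penalty [L |x - y|] is at least [2 * M], the largest possible
   oscillation of [F], so only points closer than [d] can lower the infimum. *)
pose L := 2 * M / d; have L0 : 0 <= L by rewrite divr_ge0 ?ltW// mulr_gt0.
pose S i (x : X) := [set F y i 0 + L * `|val x - val y| | y in setT]%classic.
pose P (x : X) : 'cV[R]_n := \col_i inf (S i x).
have FMi y i : `|F y i 0| <= M by apply: le_trans (cV_coord_le _ _) (FM y).
have lb i x : has_lbound (S i x).
  exists (- M) => _ [y _ <-]; have := FMi y i; rewrite ler_norml => /andP[? _].
  by rewrite ler_wpDr// mulr_ge0.
have inf_le i x y : inf (S i x) <= F y i 0 + L * `|val x - val y|.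
  by apply: ge_inf => //; exists y.
have le_inf i x z :
    (forall y, z <= F y i 0 + L * `|val x - val y|) -> z <= inf (S i x).
  move=> h; apply: lb_le_inf => [|_ [y _ <-]//].
  by exists (F x i 0 + L * `|val x - val x|), x.
have half_lip i x x' : inf (S i x) - inf (S i x') <= L * `|val x - val x'|.
  rewrite lerBlDr -lerBlDl; apply: le_inf => y; rewrite lerBlDl.
  apply: le_trans (inf_le i x y) _.
  have := ler_wpM2l L0 (ler_distD (val x') (val x) (val y)).
  by rewrite mulrDr; lra.
exists P, L; split=> // [x y|x].
  apply: cV_norm_le => [|i]; first exact: mulr_ge0.
  rewrite !mxE ler_norml half_lip andbT lerNl opprB distrC; exact: half_lip.
apply: cV_norm_le => [|i]; first exact: ltW.
rewrite !mxE ler_norml; apply/andP; split; last first.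
  have := inf_le i x x; rewrite subrr normr0 mulr0 addr0; lra.
rewrite lerBrDl; apply: le_inf => y.
have [xy|xy] := ltP `|val x - val y| d.
  have := le_trans (cV_coord_le _ i) (hF _ _ xy).
  rewrite !mxE ler_norml => /andP[? ?].
  have := mulr_ge0 L0 (normr_ge0 (val x - val y)); lra.
have : 2 * M <= L * `|val x - val y|.
  rewrite (_ : 2 * M = L * d); last by rewrite divfK// gt_eqF.
  exact: ler_wpM2l.
have := FMi x i; have := FMi y i; rewrite !ler_norml; lra.
Qed.

(** A cutoff, 1 on the ball of radius [r] about [q] and 0 off the ball of radius [2 * r], used to
    localize perturbations. *)
Definition tent (q : 'cV[R]_4) r (x : X) : R :=
  Num.max 0 (Num.min 1 (2 - `|val x - q| / r)).

Lemma tent_itv q r x : 0 <= tent q r x <= 1.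
Proof. by rewrite /tent le_max lexx /= ge_max ler01 ge_min lexx. Qed.

Lemma tent1 q r x : 0 < r -> `|val x - q| <= r -> tent q r x = 1.
Proof.
move=> r0 xq; rewrite /tent.
have : `|val x - q| / r <= 1 by rewrite ler_pdivrMr// mul1r.
by move=> ?; rewrite min_l ?max_r//; lra.
Qed.

Lemma tent0 q r x : 0 < r -> ~ `|val x - q| <= 2 * r -> tent q r x = 0.
Proof.
move=> r0 /negP; rewrite -ltNge => xq; rewrite /tent max_l//.
by rewrite ge_min; apply/orP; right; rewrite subr_le0 ler_pdivlMr// ltW.
Qed.

Lemma tent_unif_cont q r : 0 < r -> unif_cont (tent q r).
Proof.
move=> r0; apply: (@lipschitz_unif_cont _ _ r^-1) => x y.
have clamp (s t : R) :
    `|Num.max 0 (Num.min 1 s) - Num.max 0 (Num.min 1 t)| <= `|s - t|.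
  have /andP[h1 h2] : - `|s - t| <= s - t <= `|s - t| by rewrite -ler_norml.
  rewrite ler_norml; case: (lerP 1 s) => ?; case: (lerP 1 t) => ?;
    rewrite ?[Num.max 0 1]max_r//; try lra.
  - by case: (lerP 0 t) => ?; lra.
  - by case: (lerP 0 s) => ?; lra.
  - by case: (lerP 0 s) => ?; case: (lerP 0 t) => ?; lra.
apply: le_trans (clamp _ _) _.
rewrite (_ : _ - _ = (`|val y - q| - `|val x - q|) * r^-1); last by lra.
rewrite normrM mulrC [`|r^-1|]gtr0_norm ?invr_gt0//.
rewrite ler_wpM2l ?invr_ge0 ?(ltW r0)//.
have := ler_distD (val x) (val y) q; have := ler_distD (val y) (val x) q.
by rewrite ler_norml (distrC (val y) (val x)); lra.
Qed.

Lemma tent_bounded q r : bounded_map (tent q r).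
Proof.
exists 1 => // x; have /andP[t0 t1] := tent_itv q r x.
by rewrite ger0_norm.
Qed.

End UniformContinuity.

(** * Averaging and local perturbation of equivariant maps *)

Section EquivariantMaps.
Variables (R : realType) (gT : finGroupType) (G : {group gT}).
Local Notation X := (sphere R 3).
Variables (a : gT -> X -> X) (rho : gT -> 'M[R]_8).
Hypotheses (a1 : forall x, a 1%g x = x).
Hypotheses (aM : {in G &, forall g h x, a (g * h)%g x = a g (a h x)}).
Hypotheses (a_cont : {in G, forall g, unif_cont (fun x => val (a g x))}).
Hypotheses (rho1 : rho 1%g = 1%:M).
Hypotheses (rhoM : {in G &, {morph rho : g h / (g * h)%g >-> g *m h}}).

Definition equivariant_mx (F : X -> 'cV[R]_8) : Prop :=
  {in G, forall g x, F (a g x) = rho g *m F x}.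

Definition equivariant_map (F : X -> 'cV[R]_8) : Prop :=
  [/\ unif_cont F, bounded_map F & equivariant_mx F].

(** The radius [2 * r] is that of the supports of the two cutoffs: from a point of either support,
    no nontrivial group element leads back into it, and none leads into the other. *)
Definition orbit_separated (q1 q2 : 'cV[R]_4) r : Prop :=
  {in G, forall g x, `|val x - q1| <= 2 * r ->
     [/\ `|val (a g x) - q1| <= 2 * r -> g = 1%g &
         ~ `|val (a g x) - q2| <= 2 * r]} /\
  {in G, forall g x, `|val x - q2| <= 2 * r ->
     [/\ `|val (a g x) - q2| <= 2 * r -> g = 1%g &
         ~ `|val (a g x) - q1| <= 2 * r]}.

(** A quantitative form of avoiding the cone, stable under uniform perturbations small compared with
    [m]. The balls have radius [r], where the cutoffs equal 1. *)
Definition cone_margin (q1 q2 : 'cV[R]_4) r m (F : X -> 'cV[R]_8) : Prop :=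
  forall x y c, `|val x - q1| <= r -> `|val y - q2| <= r -> 0 <= c <= 1 ->
  m <= `|F x - c *: F y|.

(** The sum is not divided by the order of the group: where [f] vanishes at all other points of the
    orbit, only the identity term survives and the value is [f x] itself. *)
Definition average (f : X -> 'cV[R]_8) (x : X) : 'cV[R]_8 :=
  \sum_(g in G) rho g *m f (a g^-1%g x).

Lemma average_equivariant f : equivariant_mx (average f).
Proof.
move=> h hG x; rewrite /average mulmx_sumr (reindex_inj (mulgI h)) /=.
rewrite (eq_bigl (mem G)) => [|g]; last by rewrite groupMl.
apply: eq_bigr => g gG; rewrite rhoM// mulmxA; congr (_ *m f _).
by rewrite -aM ?groupV ?groupM// invMg mulgKV.
Qed.

Lemma average_unif_cont f : unif_cont f -> unif_cont (average f).
Proof.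
move=> ucf; apply: unif_cont_sum => g gG; apply: unif_cont_mulmx.
by apply: (@unif_cont_comp _ _ f) => //; apply: a_cont; rewrite groupV.
Qed.

Definition mx_bound : R := \sum_(g in G) \sum_i \sum_j `|rho g i j|.

Lemma mx_bound_ge0 : 0 <= mx_bound.
Proof. by do 3 (apply: sumr_ge0 => ? _). Qed.

Lemma rho_le g (v : 'cV[R]_8) : g \in G -> `|rho g *m v| <= mx_bound * `|v|.
Proof.
move=> gG; apply: le_trans (mulmx_norm_le _ _) _.
rewrite ler_wpM2r// /mx_bound (bigD1 g)//= lerDl.
by do 3 (apply: sumr_ge0 => ? _).
Qed.

Lemma average_le f e : (forall x, `|f x| <= e) ->
  forall x, `|average f x| <= mx_bound * e.
Proof.
move=> fe x; rewrite /average /mx_bound mulr_suml.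
apply: le_trans (ler_norm_sum _ _ _) (ler_sum _ _) => g gG.
apply: le_trans (mulmx_norm_le _ _) _.
by rewrite ler_wpM2l//; do 2 (apply: sumr_ge0 => ? _).
Qed.

Lemma average_id f x :
  {in G, forall g, g != 1%g -> f (a g x) = 0} -> average f x = f x.
Proof.
move=> f0; rewrite /average (bigD1 1%g) //= invg1 a1 rho1 mul1mx big1 ?addr0//.
by move=> g /andP[gG g1]; rewrite f0 ?groupV ?invg_eq1// mulmx0.
Qed.

(** The correction [f] is [w + (P - F)] near [q1] and [P - F] near [q2]. Averaging restores
    equivariance without changing [f] on the two balls, where the new map is therefore [P + w] and
    [P], with the margin of [avoid_cone]. *)
Lemma perturb (F : X -> 'cV[R]_8) q1 q2 r e :
  equivariant_map F -> 0 < r -> orbit_separated q1 q2 r -> 0 < e ->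
  exists F' m, [/\ equivariant_map F', 0 < m, cone_margin q1 q2 r m F' &
                   forall x, `|F' x - F x| <= e].
Proof.
move=> [ucF bF eF] r0 [sep1 sep2] e0.
(* The vector [w] and the two occurrences of [P - F] contribute [d] each to the bound on [f], and
   averaging costs a factor [mx_bound]; adding 1 keeps the denominator positive. *)
pose d := e / (3 * (mx_bound + 1)).
have B0 := mx_bound_ge0.
have d0 : 0 < d by rewrite divr_gt0//; lra.
have dE : mx_bound * (3 * d) <= e.
  have : e = d * (3 * (mx_bound + 1)) by rewrite divfK// gt_eqF//; lra.
  nra.
have [P [L [L0 lipP PF]]] := lipschitz_approx ucF bF d0.
have ucP := lipschitz_unif_cont lipP.
have bPF : bounded_map (fun x => P x - F x) by exists d.
have ucPF : unif_cont (fun x => P x - F x).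
  by apply: unif_contD => //; exact: unif_contN.
have [M M0 PM] : bounded_map P.
  have [M M0 FM] := bF; exists (d + M); first exact: addr_gt0.
  by move=> x; rewrite -[P x](subrK (F x)) (le_trans (ler_normD _ _))// lerD.
have [w we [m m0 wm]] := avoid_cone L0 M0 d0 lipP PM.
pose f x := tent q1 r x *: (w + (P x - F x)) + tent q2 r x *: (P x - F x).
have bw : bounded_map (fun x => w + (P x - F x)).
  exists (d + d) => [|x]; first exact: addr_gt0.
  by rewrite (le_trans (ler_normD _ _))// lerD.
have ucw : unif_cont (fun x => w + (P x - F x)).
  by apply: unif_contD => //; exact: unif_cont_cst.
have ucf : unif_cont f.
  by apply: unif_contD; apply: unif_contZ => //;
    by [exact: tent_unif_cont|exact: tent_bounded].
have f_le x : `|f x| <= 3 * d.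
  have /andP[t10 t11] := tent_itv q1 r x.
  have /andP[t20 t21] := tent_itv q2 r x.
  rewrite (le_trans (ler_normD _ _))// !normrZ !ger0_norm//.
  have h1 : tent q1 r x * `|w + (P x - F x)| <= d + d.
    apply: le_trans (ler_piMl (normr_ge0 _) t11) _.
    by rewrite (le_trans (ler_normD _ _))// lerD.
  have h2 : tent q2 r x * `|P x - F x| <= d.
    by apply: le_trans (ler_piMl (normr_ge0 _) t21) (PF x).
  by move: h1 h2; lra.
have le_2r (z : R) : z <= r -> z <= 2 * r.
  by lra.
have F1 x : `|val x - q1| <= r -> F x + average f x = P x + w.
  move=> xq; have xq2 := le_2r _ xq; rewrite average_id => [|g gG g1].
    rewrite /f tent1// [tent q2 r x]tent0//; last first.
      by have [_] := sep1 1%g (group1 G) x xq2; rewrite a1.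
    by rewrite scale0r addr0 scale1r addrCA [F x + _]addrC subrK addrC.
  have [s1 s2] := sep1 g gG x xq2.
  rewrite /f !tent0 ?scale0r ?addr0// => /s1 gE.
  by rewrite gE eqxx in g1.
have F2 x : `|val x - q2| <= r -> F x + average f x = P x.
  move=> xq; have xq2 := le_2r _ xq; rewrite average_id => [|g gG g1].
    rewrite /f [tent q2 r x]tent1// tent0//; last first.
      by have [_] := sep2 1%g (group1 G) x xq2; rewrite a1.
    by rewrite scale0r add0r scale1r addrC subrK.
  have [s1 s2] := sep2 g gG x xq2.
  rewrite /f !tent0 ?scale0r ?addr0// => /s1 gE.
  by rewrite gE eqxx in g1.
exists (fun x => F x + average f x), m; split=> //.
- split.
  + by apply: unif_contD => //; exact: average_unif_cont.
  + apply: bounded_mapD => //; exists (mx_bound * (3 * d) + 1); last first.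
      by move=> x; rewrite ler_wpDr//; exact: average_le.
    by rewrite ltr_wpDl// mulr_ge0//; lra.
  + by move=> g gG x; rewrite eF// average_equivariant// mulmxDr.
- by move=> x y c xq1 yq2 c01; rewrite F1// F2//; exact: wm.
- by move=> x; rewrite addrC addKr; apply: le_trans (average_le f_le x) dE.
Qed.

End EquivariantMaps.

(** Stage [k] secures condition [k] with some margin. Later margins at least halve at each stage and
    each move is at most an eighth of the current margin, so all later moves together stay within a
    quarter of it. *)
Lemma baire_limit (R : realType) (X : Type) d (E : (X -> 'cV[R]_d) -> Prop)
    (cond : nat -> R -> (X -> 'cV[R]_d) -> Prop) (F0 : X -> 'cV[R]_d) :
  E F0 ->
  (forall k m m' F, m' <= m -> cond k m F -> cond k m' F) ->
  (forall k F e, E F -> 0 < e -> exists F' m,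
     [/\ E F', 0 < m, cond k m F' & forall x, `|F' x - F x| <= e]) ->
  exists F,
    (forall e, 0 < e -> exists2 F', E F' & forall x, `|F x - F' x| <= e) /\
    (forall k, exists F' m,
       [/\ 0 < m, cond k m F' & forall x, `|F x - F' x| <= m / 4]).
Proof.
move=> EF0 cond_le perturb.
pose state := {s : (X -> 'cV[R]_d) * R | E s.1 /\ 0 < s.2}.
have /choice[next nextP] (ks : nat * state) : exists s' : state,
    [/\ cond ks.1 (sval s').2 (sval s').1, (sval s').2 <= (sval ks.2).2 / 2 &
     forall x, `|(sval s').1 x - (sval ks.2).1 x| <= (sval ks.2).2 / 8].
  case: ks => k [[F m] /= [EF m0]].
  have m8 : 0 < m / 8 by lra.
  have [F' [m' [EF' m'0 c' F'F]]] := perturb k F _ EF m8.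
  have mm0 : 0 < Num.min m' (m / 2) by rewrite lt_min m'0; lra.
  exists (exist _ (F', Num.min m' (m / 2)) (conj EF' mm0)); split => //=.
    by apply: cond_le c'; rewrite ge_min lexx.
  by rewrite ge_min lexx orbT.
pose s0 : state := exist _ (F0, 1) (conj EF0 ltr01).
pose u := fix u n : state := if n is k.+1 then next (k, u k) else s0.
pose f n := (sval (u n)).1; pose m n := (sval (u n)).2.
have Ef n : E (f n) by have [] := svalP (u n).
have m_gt0 n : 0 < m n by have [] := svalP (u n).
have m_half n : m n.+1 <= m n / 2 by have [] := nextP (n, u n).
have f_next n x : `|f n.+1 x - f n x| <= m n / 8.
  by have [_ _] := nextP (n, u n); exact.
have condP n : cond n (m n.+1) (f n.+1) by have [] := nextP (n, u n).
(* These intervals are nested: a move of [m n / 8] plus the next half-width, at most [m n / 8], fits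
   into [m n / 4]. The supremum of the left ends is thus the limit. *)
pose lo x i n := f n x i 0 - m n / 4; pose hi x i n := f n x i 0 + m n / 4.
have f_nexti n x i : `|f n.+1 x i 0 - f n x i 0| <= m n / 8.
  by have := le_trans (cV_coord_le _ i) (f_next n x); rewrite !mxE.
have lo_mono x i p n : (p <= n)%N -> lo x i p <= lo x i n.
  move=> /subnK <-; elim: (n - p)%N => [|q IH] //; apply: le_trans IH _.
  rewrite addSn /lo; have := f_nexti (q + p)%N x i; have := m_half (q + p)%N.
  by rewrite ler_norml; lra.
have hi_mono x i p n : (p <= n)%N -> hi x i n <= hi x i p.
  move=> /subnK <-; elim: (n - p)%N => [|q IH] //; apply: le_trans _ IH.
  rewrite addSn /hi; have := f_nexti (q + p)%N x i; have := m_half (q + p)%N.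
  by rewrite ler_norml; lra.
have lo_hi x i p n : lo x i p <= hi x i n.
  apply: le_trans (lo_mono x i _ _ (leq_maxl p n)) _.
  apply: le_trans _ (hi_mono x i _ _ (leq_maxr p n)).
  by rewrite /lo /hi; have := m_gt0 (maxn p n); lra.
pose S x i := [set lo x i n | n in setT]%classic.
pose F x : 'cV[R]_d := \col_i sup (S x i).
have Ff n x : `|F x - f n x| <= m n / 4.
  apply: cV_norm_le => [|i]; first by have := m_gt0 n; lra.
  have lo_le : lo x i n <= sup (S x i).
    by apply: ub_le_sup; [exists (hi x i 0%N) => _ [p _ <-]|exists n].
  have le_hi : sup (S x i) <= hi x i n.
    by apply: ge_sup => [|_ [p _ <-] //]; exists (lo x i 0%N), 0%N.
  by move: lo_le le_hi; rewrite !mxE ler_norml /lo /hi; lra.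
exists F; split=> [e e0|k]; last by exists (f k.+1), (m k.+1).
(* Halving from [m 0 = 1] makes the margins tend to 0, so the convergence is uniform. *)
have m_small n : m n * n.+1%:R <= 1.
  elim: n => [|n IH]; first by rewrite mulr1.
  have : (1 : R) <= n.+1%:R by rewrite ler1n.
  have := m_half n; have := m_gt0 n; move: IH; rewrite -[n.+2%:R]natr1; nra.
pose n := Num.trunc e^-1; exists (f n) => // x; apply: le_trans (Ff n x) _.
have /andP[_ en] : (n%:R <= e^-1 < n.+1%:R) by rewrite trunc_itv// invr_ge0 ltW.
have : 1 <= e * n.+1%:R by rewrite -ler_pdivrMl// mulr1 ltW.
have := m_small n; have := m_gt0 n; have : (0 : R) < n.+1%:R by rewrite ltr0n.
nra.
Qed.

(** Supplies countably many centres for the balls; they need not lie on the sphere. *)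
Lemma rat_approx (R : realType) n (x : 'cV[R]_n) e : 0 < e ->
  exists q : 'cV[rat]_n, `|x - map_mx ratr q| <= e.
Proof.
move=> e0.
have /choice[q qP] i : exists q : rat, `|x i 0 - ratr q| <= e.
  have [q] : exists q : rat, ratr q \in `]x i 0 - e, x i 0 + e[.
    by apply: rat_in_itvoo; lra.
  by rewrite in_itv /= => /andP[? ?]; exists q; rewrite ler_norml; lra.
exists (\col_i q i); apply: cV_norm_le => [|i]; first exact: ltW.
by rewrite !mxE.
Qed.

(** * Existence of a generic equivariant map *)

Section GenericMap.
Variables (R : realType) (gT : finGroupType) (G : {group gT}).
Local Notation X := (sphere R 3).
Variables (a : gT -> X -> X) (rho : gT -> 'M[R]_8).
Hypotheses (a1 : forall x, a 1%g x = x).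
Hypotheses (aM : {in G &, forall g h x, a (g * h)%g x = a g (a h x)}).
Hypotheses (a_cont : {in G, forall g, unif_cont (fun x => val (a g x))}).
Hypotheses (a_free : {in G, forall g, g != 1%g -> forall x, a g x <> x}).
Hypotheses (rho1 : rho 1%g = 1%:M).
Hypotheses (rhoM : {in G &, {morph rho : g h / (g * h)%g >-> g *m h}}).

(** Since the action is free and the orbits differ, finitely many distances between translates of
    [x] and [y] are positive, and uniform continuity preserves this nearby. *)
Lemma separated_near x y : {in G, forall g, a g x <> y} ->
  exists2 s, 0 < s & forall q1 q2 r, 0 < r <= s ->
    `|val x - q1| <= r -> `|val y - q2| <= r -> orbit_separated G a q1 q2 r.
Proof.
move=> xy.
have norm_pos (u v : X) : u <> v -> 0 < `|val u - val v|.
  by move=> uv; rewrite normr_gt0 subr_eq0; apply/eqP => /val_inj.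
have ygx g : g \in G -> a g y <> x.
  move=> gG e; apply: (xy g^-1%g); rewrite ?groupV// -e -aM ?groupV//.
  by rewrite mulVg a1.
(* For [g = 1] only the distance from [x] to [y] matters; the value 1 is a placeholder. *)
pose dist (g : gT) := Num.min
  (Num.min (`|val (a g x) - val y|) (`|val (a g y) - val x|))
  (if g == 1%g then 1 else
   Num.min (`|val (a g x) - val x|) (`|val (a g y) - val y|)).
have dist0 g : g \in G -> 0 < dist g.
  move=> gG; rewrite !lt_min !norm_pos/=; [|exact: ygx|exact: xy].
  by case: eqP => // /eqP g1; rewrite lt_min !norm_pos//; exact: a_free.
have uniform (P : gT -> R -> Prop) :
    (forall g s s', 0 < s' <= s -> P g s -> P g s') ->
    {in G, forall g, exists2 s, 0 < s & P g s} ->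
    exists2 s, 0 < s & {in G, forall g, P g s}.
  move=> P_le PG.
  have /choice[s sP] g : exists s, 0 < s /\ (g \in G -> P g s).
    case gG : (g \in G); last by exists 1.
    by have [s s0 Ps] := PG g gG; exists s.
  exists (\big[Num.min/1]_g s g).
    by apply: lt_bigmin => // g _; have [] := sP g.
  move=> g gG; have [s0 Ps] := sP g; apply: P_le (Ps gG).
  rewrite bigmin_le_cond// andbT; apply: lt_bigmin => // h _.
  by have [] := sP h.
(* Points within [2 * r] and [r] of a common centre are at most [3 * s] apart. A translate ending
   within [2 * r] of the other centre would give a distance of at most [dist g / 4 + 3 * s], less
   than [dist g]. *)
pose P g s := 6 * s < dist g /\ forall u v,
  `|val u - val v| <= 3 * s -> `|val (a g u) - val (a g v)| <= dist g / 4.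
have [s s0 sP] : exists2 s, 0 < s & {in G, forall g, P g s}.
  apply: uniform.
    move=> g s s' /andP[s'0 s's] [h1 h2]; split=> [|u v uv]; first lra.
    by apply: h2; lra.
  move=> g gG; have dg := dist0 g gG.
  have /(a_cont gG)[d d0 hd] : 0 < dist g / 4 by lra.
  exists (Num.min (d / 4) (dist g / 8)); first by rewrite lt_min; lra.
  split=> [|u v uv].
    have : Num.min (d / 4) (dist g / 8) <= dist g / 8.
      by rewrite ge_min lexx orbT.
    by lra.
  apply: hd; have : Num.min (d / 4) (dist g / 8) <= d / 4.
    by rewrite ge_min lexx.
  by lra.
exists s => // q1 q2 r /andP[r0 rs] xq yq.
have far g (u v z : X) p q : g \in G -> dist g <= `|val (a g u) - val v| ->
    `|val u - p| <= r -> `|val v - q| <= r ->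
    `|val z - p| <= 2 * r -> ~ `|val (a g z) - q| <= 2 * r.
  move=> gG dg up vq zp azq; have [h1 h2] := sP g gG.
  have zu : `|val z - val u| <= 3 * s.
    move: zp up rs (ler_distD p (val z) (val u)); rewrite (distrC p).
    by lra.
  move: (h2 _ _ zu) h1 dg vq azq rs.
  have := ler_distD (val (a g z)) (val (a g u)) (val v).
  have := ler_distD q (val (a g z)) (val v).
  by rewrite (distrC q) (distrC (val (a g u)) (val (a g z))); lra.
have dist_le g : [/\ dist g <= `|val (a g x) - val y|,
    dist g <= `|val (a g y) - val x|,
    g != 1%g -> dist g <= `|val (a g x) - val x| &
    g != 1%g -> dist g <= `|val (a g y) - val y|].
  rewrite /dist !ge_min !lexx ?orbT; split=> // /negPf ->.
    by rewrite ge_min lexx !orbT.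
  by rewrite ge_min lexx !orbT.
split=> g gG z zq; have [d1 d2 d3 d4] := dist_le g; split.
- by move=> azq; apply: contrapT => /eqP/d3 dg; exact: (far g x x z q1 q1).
- exact: (far g x y z q1 q2).
- by move=> azq; apply: contrapT => /eqP/d4 dg; exact: (far g y y z q2 q2).
- exact: (far g y x z q2 q1).
Qed.

(** The conditions are indexed by two rational centres and a radius [1 / (n + 1)]. Any two points in
    different orbits lie in some such pair of separated balls. *)
Lemma generic_map : exists F : X -> 'cV[R]_8,
  equivariant_map G a rho F /\
  forall x y c, {in G, forall g, a g x <> y} -> 0 <= c <= 1 ->
    F x <> c *: F y.
Proof.
pose index := ('cV[rat]_4 * 'cV[rat]_4 * nat)%type.
pose centre (q : 'cV[rat]_4) : 'cV[R]_4 := map_mx ratr q.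
(* The condition is vacuous for codes of no index and for balls that are not separated, so it can
   always be met. *)
pose cond k m F := if @unpickle index k is Some (q1, q2, n) then
  orbit_separated G a (centre q1) (centre q2) n.+1%:R^-1 ->
  cone_margin (centre q1) (centre q2) n.+1%:R^-1 m F else True.
have [||k F e eqF e0|F [Fapprox Fcond]] :=
    @baire_limit R X 8 (equivariant_map G a rho) cond (fun=> 0).
- split; first exact: unif_cont_cst.
    by exists 1 => // x; rewrite normr0.
  by move=> g gG x; rewrite mulmx0.
- move=> k m m' F m'm; rewrite /cond; case: unpickle => [[[q1 q2] n]|//] h sep.
  by move=> x y c xq yq c01; apply: le_trans m'm _; exact: h.
- have trivial : exists F' m, [/\ equivariant_map G a rho F', (0 : R) < m,
      True & forall x, `|F' x - F x| <= e].
    by exists F, 1; split=> // x; rewrite subrr normr0 ltW.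
  rewrite /cond; case: unpickle => [[[q1 q2] n]|//].
  have [sep|nsep] := pselect
      (orbit_separated G a (centre q1) (centre q2) n.+1%:R^-1).
    have r0 : (0 : R) < n.+1%:R^-1 by rewrite invr_gt0 ltr0n.
    have [F' [m [? ? ? ?]]] := perturb a1 aM a_cont rho1 rhoM eqF r0 sep e0.
    by exists F', m.
  by have [F' [m [? ? ? ?]]] := trivial; exists F', m.
exists F; split.
  split.
  - move=> e e0; have e4 : 0 < e / 4 by lra.
    have [F' [ucF' _ _] FF'] := Fapprox _ e4.
    have [d d0 dP] := ucF' _ e4; exists d => // x y /dP F'xy.
    have := ler_distD (F' x) (F x) (F y); have := ler_distD (F' y) (F' x) (F y).
    by have := FF' x; have := FF' y; rewrite (distrC (F' y) (F y)); lra.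
  - have [F' [_ [M M0 MP] _] FF'] := Fapprox 1 ltr01.
    exists (1 + M) => [|x]; first exact: addr_gt0.
    by rewrite -[F x](subrK (F' x)) (le_trans (ler_normD _ _))// lerD.
  (* The defect of equivariance of [F] is at most [1 + mx_bound] times its distance to an
     equivariant map, hence arbitrarily small. *)
  - move=> g gG x; apply/eqP; rewrite -subr_eq0 -normr_le0.
    apply/ler_addgt0Pl => e e0; rewrite addr0.
    have B0 := mx_bound_ge0 G rho.
    have d0 : 0 < e / (mx_bound G rho + 1) by rewrite divr_gt0//; lra.
    have [F' [_ _ eqF'] FF'] := Fapprox _ d0.
    have dE : e = e / (mx_bound G rho + 1) * (mx_bound G rho + 1).
      by rewrite divfK// gt_eqF//; lra.
    have -> : F (a g x) - rho g *m F x =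
        (F (a g x) - F' (a g x)) + rho g *m (F' x - F x).
      by rewrite mulmxBr -eqF'// addrA subrK.
    apply: le_trans (ler_normD _ _) _.
    have := rho_le rho (F' x - F x) gG; have := FF' (a g x); have := FF' x.
    rewrite (distrC (F x)) {3}dE; move: (e / _) d0 => d d0; nra.
move=> x y c xy c01 Fxy.
have [s s0 sP] := separated_near xy.
pose n := Num.trunc s^-1; pose r : R := n.+1%:R^-1.
have r0 : 0 < r by rewrite invr_gt0 ltr0n.
have rs : r <= s.
  rewrite -[s]invrK lef_pV2 ?posrE ?invr_gt0 ?ltr0n//.
  have /andP[_ /ltW //] : n%:R <= s^-1 < n.+1%:R.
  by rewrite trunc_itv// invr_ge0 ltW.
have [q1 xq1] := rat_approx (val x) r0; have [q2 yq2] := rat_approx (val y) r0.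
have [F' [m [m0 + FF']]] := Fcond (pickle (q1, q2, n)).
rewrite /cond pickleK => margin.
have sep : orbit_separated G a (centre q1) (centre q2) r.
  by apply: sP => //; rewrite r0.
have := margin sep x y c xq1 yq2 c01.
(* If [F x = c *: F y], the left side has norm at most [m / 4 + m / 4], contradicting the margin
   [m]. *)
rewrite (_ : F' x - c *: F' y = c *: (F y - F' y) - (F x - F' x)); last first.
  by rewrite scalerBr -Fxy opprB [RHS]addrC addrA subrK.
have /andP[c0 c1] := c01.
have := ler_normB (c *: (F y - F' y)) (F x - F' x).
rewrite normrZ (ger0_norm c0).
have := FF' x; have := FF' y; have := ler_piMl (normr_ge0 (F y - F' y)) c1; lra.
Qed.
End GenericMap.

(** * Topology of spheres *)

Local Open Scope classical_set_scope.

Section SphereTopology.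
Variable R : realType.

Lemma continuous_sum_sqr (T : topologicalType) (I : Type) (r : seq I)
    (f : I -> T -> R) :
  (forall i, continuous (f i)) ->
  continuous (fun x => \sum_(i <- r) f i x ^+ 2).
Proof.
move=> fC; elim: r => [|i r IH] x.
  rewrite (_ : (fun x => _) = cst 0); first exact: cvg_cst.
  by apply/funext => y; rewrite big_nil.
rewrite (_ : (fun x => _) =
    (fun y => f i y ^+ 2) \+ (fun y => \sum_(j <- r) f j y ^+ 2)).
  apply: continuousD; last exact: IH.
  exact: (@continuous_comp _ _ _ (f i) (fun z : R => z ^+ 2) x (fC i x)
    (@exprn_continuous _ 2 _)).
by apply/funext => y /=; rewrite big_cons.
Qed.

Lemma sphere_val_continuous k :
  continuous (set_val : sphere R k -> 'cV[R]_k.+1).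
Proof. exact: initial_continuous. Qed.

Lemma nbhs_sphere k (x : sphere R k) (A : set (sphere R k)) :
  nbhs x A <-> exists2 d, 0 < d & forall y, `|val x - val y| < d -> A y.
Proof.
split=> [|[d d0 dA]]; last first.
  rewrite nbhsE; exists (set_val @^-1` ball (set_val x : 'cV[R]_k.+1) d).
    split; last exact: ballxx.
    by exists (ball (set_val x : 'cV[R]_k.+1) d) => //; exact: ball_open.
  by move=> y; rewrite /= -ball_normE; exact: dA.
rewrite nbhsE => -[U [[V oV VU] Ux] UA].
have /nbhs_ballP[d /= d0 dV] : nbhs (val x : 'cV[R]_k.+1) V.
  by apply: open_nbhs_nbhs; split=> //; move: Ux; rewrite -VU.
by exists d => // y xy; apply: UA; rewrite -VU; apply: dV; rewrite -ball_normE.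
Qed.

Lemma sphere_hausdorff k : hausdorff_space (sphere R k).
Proof.
move=> x y xy; apply: val_inj.
apply: (@norm_hausdorff _ 'cV[R]_k.+1) => A B nA nB.
have [z [Az Bz]] := xy _ _ (@sphere_val_continuous k x A nA)
                           (@sphere_val_continuous k y B nB).
by exists (set_val z).
Qed.

(** Heine-Borel applies to the transposed sphere of row vectors; a cluster point there is transposed
    back. *)
Lemma sphere_compact k : compact [set: sphere R k].
Proof.
pose S := [set v : 'rV[R]_k.+1 | \sum_i v 0 i ^+ 2 = 1].
have cptS : compact S.
  apply: bounded_closed_compact.
    exists 1; split; first exact: num_real.
    move=> M M1 v Sv; suff : `|v| <= M by [].
    rewrite [leLHS]/Num.Def.normr /= mx_normrE.
    apply: bigmax_le => [|[i j] _ /=]; first lra.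
    rewrite (ord1 i); have : v 0 j ^+ 2 <= 1.
      by rewrite -Sv (bigD1 j)//= lerDl; apply: sumr_ge0 => l _; exact: sqr_ge0.
    by rewrite expr2 ler_norml; nra.
  apply: (@preimage_closed _ _ (fun v : 'rV[R]_k.+1 => \sum_i v 0 i ^+ 2)
    [set x : R | x = 1]).
    move=> v _; apply: continuous_sum_sqr => i; exact: coord_continuous.
  exact: closed_eq.
move=> F FF _; pose row (x : sphere R k) : 'rV[R]_k.+1 := (val x)^T.
have rowS : row @^-1` S = setT.
  apply/seteqP; split=> // x _; rewrite /S /=.
  by rewrite -[RHS](set_mem (valP x)); apply: eq_bigr => i _; rewrite mxE.
have rowFS : (row @ F) S.
  by change (F (row @^-1` S)); rewrite rowS; exact: filterT.
have [v [Sv vF]] := cptS (row @ F) _ rowFS.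
have vS : v^T \in @unit_sphere R k.
  apply/mem_set; change (\sum_i v^T i 0 ^+ 2 = 1 :> R).
  by rewrite -[RHS]Sv; apply: eq_bigr => i _; rewrite mxE.
exists (exist _ v^T vS : sphere R k); split=> // A B FA /nbhs_sphere[d d0 dB].
have rowFA : (row @ F) (row @` A).
  change (F (row @^-1` (row @` A))).
  by apply: filterS FA; exact: preimage_image.
have [w [[z Az zw] /= vw]] := vF _ _ rowFA (nbhsx_ballx _ _ d0).
exists z; split=> //; apply: dB => /=.
move: vw; rewrite -ball_normE /= -zw => vz.
apply: le_lt_trans vz; apply: cV_norm_le => // i.
rewrite [leRHS]/Num.Def.normr /= mx_normrE.
pose entry (ij : 'I_1 * 'I_k.+1) := `|(v - row z) ij.1 ij.2|.
by apply: (le_trans _ (le_bigmax _ entry (0, i))); rewrite /entry /row /= !mxE.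
Qed.

(** Heine-Cantor, through the near-covering form of compactness. *)
Lemma continuous_unif_cont (f : sphere R 3 -> sphere R 3) :
  continuous f -> unif_cont (fun x => val (f x) : 'cV[R]_4).
Proof.
move=> fC e e0.
pose P d (x : sphere R 3) := forall y : sphere R 3,
  `|val x - val y| < d -> `|(val (f x) : 'cV[R]_4) - val (f y)| <= e.
have : \forall d \near 0^'+, [set: sphere R 3] `<=` P d.
  have cover :=
    (compact_near_coveringP [set: sphere R 3]).1 (@sphere_compact 3).
  apply: (cover R (0 : R)^'+ P _) => x _.
  have e2 : 0 < e / 2 by lra.
  pose V : set (sphere R 3) := [set z | `|val (f x) - val z| < e / 2].
  have /nbhs_sphere[d d0 dP] : nbhs x (f @^-1` V).
    by apply: fC; apply/nbhs_sphere; exists (e / 2).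
  have d2 : 0 < d / 2 by lra.
  have dd : d / 2 < d by lra.
  pose U : set (sphere R 3) := [set y | `|val x - val y| < d / 2].
  exists (U, [set r : R | r < d / 2]).
    split; first by apply/nbhs_sphere; exists (d / 2).
    exact: nbhs_right_lt.
  move=> [y r] [/= xy rd] z yz.
  have fy : `|val (f x) - val (f y)| < e / 2 by exact: dP (lt_trans xy dd).
  have fz : `|val (f x) - val (f z)| < e / 2.
    apply: dP; apply: le_lt_trans (ler_distD (val y) _ _) _.
    by rewrite [d]splitr ltrD// (lt_trans yz rd).
  rewrite (le_trans (ler_distD (val (f x)) _ _))// [e]splitr.
  by rewrite lerD ?(ltW fz)// distrC ltW.
move=> near0.
have [d [dP d0]] : exists d : R, [set: sphere R 3] `<=` P d /\ 0 < d.
  have : \forall d \near (0 : R)^'+, [set: sphere R 3] `<=` P d /\ 0 < d.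
    by apply: filterI => //; exact: nbhs_right_gt.
  exact: filter_ex.
by exists d => // x y; exact: dP.
Qed.

(** A continuous map from a compact space to a Hausdorff space is closed, so the image of the
    complement of [U] has an open complement, whose preimage is [U] by injectivity. *)
Lemma continuous_injective_embedding k l (e : sphere R k -> sphere R l) :
  continuous e -> injective e -> embedding e.
Proof.
move=> eC e_inj; split=> // U oU.
exists (~` (e @` ~` U)).
  apply: closed_openC; apply: compact_closed; first exact: sphere_hausdorff.
  apply: continuous_compact; first exact: continuous_subspaceT.
  exact: subclosed_compact (open_closedC oU) (sphere_compact (k := k)) _.
apply/seteqP; split=> x /=.
  by move=> nx; apply: contrapT => Ux; apply: nx; exists x.
by move=> Ux [y Uy /e_inj yx]; apply: Uy; rewrite yx.
Qed.

End SphereTopology.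

(** * From the generic map to an equivariant embedding *)

Section Embedding.
Variables (R : realType) (gT : finGroupType) (G : {group gT}).

Definition sum_sqr n (v : 'cV[R]_n) : R := \sum_i v i 0 ^+ 2.

Lemma sum_sqrE n (v : 'cV[R]_n) : (v^T *m v) 0 0 = sum_sqr v.
Proof. by rewrite mxE; apply: eq_bigr => i _; rewrite mxE expr2. Qed.

Lemma sum_sqrZ n c (v : 'cV[R]_n) : sum_sqr (c *: v) = c ^+ 2 * sum_sqr v.
Proof.
by rewrite /sum_sqr mulr_sumr; apply: eq_bigr => i _; rewrite mxE exprMn.
Qed.

Lemma sum_sqr_ge0 n (v : 'cV[R]_n) : 0 <= sum_sqr v.
Proof. by apply: sumr_ge0 => i _; exact: sqr_ge0. Qed.

Lemma sum_sqr_eq0 n (v : 'cV[R]_n) : sum_sqr v = 0 -> v = 0.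
Proof.
move=> /eqP; rewrite psumr_eq0 => [/allP v0|i _]; last exact: sqr_ge0.
apply/matrixP => i j; rewrite (ord1 j) !mxE; apply/eqP.
by rewrite -sqrf_eq0; apply: v0; rewrite mem_index_enum.
Qed.

Lemma sum_sqr_SO n (A : 'M[R]_n) v : SO A -> sum_sqr (A *m v) = sum_sqr v.
Proof.
move=> [/mulmx1C AA _].
by rewrite -!sum_sqrE trmx_mul mulmxA -(mulmxA _ _ A) AA mulmx1.
Qed.

(** The map [a 1] is idempotent and injective. *)
Lemma top_action1 k (a : gT -> sphere R k -> sphere R k) x :
  top_action G a -> a 1%g x = x.
Proof.
move=> [homeo mul]; have [[g [_ can_a _]] _] := homeo 1%g (group1 G).
apply: (can_inj can_a).
have /(congr1 (fun f => f x)) := mul _ _ (group1 G) (group1 G).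
by rewrite mulg1 /= => <-.
Qed.

(** The points [(t, sqrt (1 - t^2), 0, 0)] with [t = k / (N + 1)] outnumber the group; the last two
    coordinates are the default of [nth]. *)
Lemma exists_off_orbit (a : gT -> sphere R 3 -> sphere R 3) x :
  exists y, forall g, a g x <> y.
Proof.
pose N := #|gT|; pose t (k : 'I_N.+1) : R := k%:R / N.+1%:R.
have N0 : (0 : R) < N.+1%:R by rewrite ltr0n.
have t0 k : 0 <= t k by rewrite divr_ge0 ?ler0n.
have t1 k : t k <= 1 by rewrite ler_pdivrMr// mul1r ler_nat ltnW.
pose p k : 'cV[R]_4 := \col_i nth 0 [:: t k; Num.sqrt (1 - t k ^+ 2)] i.
have pS k : p k \in @unit_sphere R 3.
  apply/mem_set; change (\sum_i p k i 0 ^+ 2 = 1).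
  rewrite !big_ord_recl big_ord0 !mxE /= sqr_sqrtr ?expr0n /=; first by lra.
  by have := t0 k; have := t1 k; rewrite expr2; nra.
apply: contrapT => /forallNP onto.
have /choice[h hP] k : exists g, val (a g x) = p k.
  apply: contrapT => /forallNP pk.
  by apply: (onto (exist _ (p k) (pS k))) => g e; apply: (pk g); rewrite e.
have h_inj : injective h.
  move=> k k' hk; have := hP k; rewrite hk hP => /matrixP/(_ 0 0).
  rewrite !mxE /= => /(congr1 (fun z => z * N.+1%:R)).
  rewrite !divfK ?gt_eqF// => /eqP; rewrite eqr_nat => /eqP e.
  exact: ord_inj.
by have := leq_card h h_inj; rewrite card_ord ltnn.
Qed.

Lemma free_action_embeds (a : gT -> sphere R 3 -> sphere R 3)
    (rho : mx_representation R G 8) :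
  top_action G a -> free_action G a ->
  {in G, forall g, SO (rho g)} ->
  {in G, forall g, g != 1%g -> forall v : 'cV[R]_8, rho g *m v = v -> v = 0} ->
  exists2 b : gT -> sphere R 7 -> sphere R 7,
    free_linear_action G b & embeds_in G a b.
Proof.
move=> act_a free_a rhoSO rho_free.
have a1 x := top_action1 x act_a.
have aM : {in G &, forall g h x, a (g * h)%g x = a g (a h x)}.
  by move=> g h gG hG x; rewrite act_a.2.
have a_cont : {in G, forall g, unif_cont (fun x => val (a g x) : 'cV[R]_4)}.
  move=> g gG; apply: continuous_unif_cont.
  by have [_ [ag_cont _]] := act_a.1 g gG.
have [rho1 rhoM] : mx_repr G rho by case: (rho).
have [F [[ucF _ eqF] Fcone]] := generic_map a1 aM a_cont free_a rho1 rhoM.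
have F_neq0 x : F x <> 0.
  have [y xy] := exists_off_orbit a x.
  (* The case [c = 0] of the cone condition is the nonvanishing of [F]. *)
  by rewrite -(scale0r (F y)); apply: Fcone; rewrite ?lexx ?ler01.
pose n x := Num.sqrt (sum_sqr (F x)).
have n_gt0 x : 0 < n x.
  rewrite sqrtr_gt0 lt_def sum_sqr_ge0 andbT.
  by apply/eqP => /sum_sqr_eq0; exact: F_neq0.
have nE x : n x ^+ 2 = sum_sqr (F x) by rewrite sqr_sqrtr ?sum_sqr_ge0.
have n_inv : {in G, forall g x, n (a g x) = n x}.
  by move=> g gG x; rewrite /n eqF// sum_sqr_SO//; exact: rhoSO.
have eS x : (n x)^-1 *: F x \in @unit_sphere R 7.
  apply/mem_set; change (sum_sqr ((n x)^-1 *: F x) = 1).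
  by rewrite sum_sqrZ -nE exprVn mulVf// gt_eqF// exprn_gt0.
pose e x : sphere R 7 := exist _ ((n x)^-1 *: F x) (eS x).
(* The default [x] is returned only for [g] outside [G], where [rho g] may leave the sphere. *)
pose b g (x : sphere R 7) : sphere R 7 := insubd x (rho g *m val x).
have bE g x : g \in G -> val (b g x) = rho g *m val x.
  move=> gG; apply: insubdK; apply/mem_set.
  change (sum_sqr (rho g *m (val x : 'cV[R]_8)) = 1).
  rewrite sum_sqr_SO; last exact: rhoSO.
  exact: set_mem (valP x).
exists b.
  split; first by exists rho => g gG; split=> [|x]; [exact: rhoSO|exact: bE].
  move=> g gG g1 x /(congr1 val); rewrite bE// => /(rho_free g gG g1) x0.
  have : sum_sqr (val x : 'cV[R]_8) = 1 by exact: set_mem (valP x).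
  rewrite x0 /sum_sqr big1 => [/eqP|i _]; first by rewrite eq_sym oner_eq0.
  by rewrite mxE expr0n.
exists e; last first.
  move=> g gG x; apply: val_inj; rewrite bE// /= eqF// n_inv//.
  by rewrite scalemxAr.
have F_cont : continuous F.
  move=> x.
  apply/(@cvgrPdist_le R _ _ _ (@nbhs_filter (sphere R 3) x)) => eps eps0.
  have [d d0 dP] := ucF _ eps0.
  by apply/(nbhs_sphere x); exists d => // y /dP.
have n_cont : continuous n.
  move=> x; apply: (@continuous_comp _ _ _ (fun y => sum_sqr (F y)) Num.sqrt).
    apply: (@continuous_sum_sqr R _ _ _ (fun i y => F y i 0)) => i y.
    exact: (@continuous_comp _ _ _ F (fun v : 'cV[R]_8 => v i 0) y (F_cont y)
      (@coord_continuous _ _ _ _ _ _)).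
  exact: sqrt_continuous.
apply: continuous_injective_embedding.
  apply: (@continuous_comp_initial (sphere R 7) _ _ set_val e) => x.
  apply: (@continuousZ _ _ _ (fun y => (n y)^-1) F x); last exact: F_cont.
  exact: (cvgV (lt0r_neq0 (n_gt0 x)) (n_cont x)).
move=> x y /(congr1 val) /= exy.
have Fxy : F x = (n x / n y) *: F y.
  by rewrite -scalerA -exy scalerA divff ?gt_eqF// scale1r.
have Fyx : F y = (n y / n x) *: F x.
  by rewrite -scalerA exy scalerA divff ?gt_eqF// scale1r.
(* On an orbit [n] is constant, so equal directions make [rho g] fix the nonzero vector [F x], which
   forces [g = 1]. *)
have [[g gG gxy]|off] := pselect (exists2 g, g \in G & a g x = y).
  have [g1|/eqP g1] := eqVneq g 1%g; first by rewrite -gxy g1 a1.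
  case: (F_neq0 x); apply: (rho_free g gG); first exact/eqP.
  by rewrite -eqF// gxy Fyx -gxy n_inv// divff ?gt_eqF// scale1r.
(* Across orbits, dividing the smaller norm by the larger gives a ratio in [[0, 1]], as the cone
   condition demands. *)
have [nxy|nyx] := leP (n x) (n y).
  case: (Fcone x y (n x / n y)) => //.
    by move=> g gG gxy; apply: off; exists g.
  by rewrite divr_ge0 ?(ltW (n_gt0 _))//= ler_pdivrMr ?n_gt0// mul1r.
case: (Fcone y x (n y / n x)) => //.
  move=> g gG gyx; apply: off; exists g^-1%g; first by rewrite groupV.
  by rewrite -gyx -aM ?groupV// mulVg a1.
by rewrite divr_ge0 ?(ltW (n_gt0 _))//= ler_pdivrMr ?n_gt0// mul1r ltW.
Qed.

End Embedding.

Close Scope classical_set_scope.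
Close Scope ring_scope.

Theorem theorem11 (R : realType)
    (a : {'GL_2(5)} -> sphere R 3 -> sphere R 3) (C : {group {'GL_2(5)}}) :
  top_action SL2_5 a ->
  free_action SL2_5 a ->
  C \subset SL2_5 -> cyclic C -> #|C| = 5 ->
  (exists2 l : {'GL_2(5)} -> sphere R 3 -> sphere R 3,
     free_linear_action C l & conjugate_actions C a l) ->
  exists2 b : {'GL_2(5)} -> sphere R 7 -> sphere R 7,
    free_linear_action SL2_5 b & embeds_in SL2_5 a b.
Proof.
move=> act_a free_a _ _ _ _.
apply: (free_action_embeds (rho := icosian_rep R)) => //.
  exact: icosian_rep_SO.
by move=> g gG g1 v; exact: icosian_rep_fixed.
Qed.
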